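(* Let $(G_n)_{n\ge 2}$ be a sequence of random graphs following the inverse de-preferential attachment model with $m=1$, and let $i\ge 1$ be fixed. Let $\lambda^*>0$ satisfy $\sum_{n=1}^{\infty}\prod_{l=1}^{n}\frac{1}{1+l\lambda^*}=1$. Then, as $n\to\infty$, $$\frac{d_i(n)}{\sqrt{\log n}}\longrightarrow\sqrt{\frac{2}{\lambda^*}}\quad\text{almost surely.}$$
   Context: Inverse de-preferential attachment model with $m=1$: the graph $G_n$ has vertices $v_1,\dots,v_n$, and $d_i(n)$ denotes the degree of $v_i$ in $G_n$ (all incident edges and half-edges counted). The process starts from $G_2$, consisting of two vertices $v_1,v_2$ joined by an edge together with one extra ''free'' edge (half-edge) attached to one of the two vertices, which counts toward that vertex's degree; thus the degrees in $G_2$ are $1$ and $2$. Given $G_n$, a new vertex $v_{n+1}$ is added with a single edge $e_{n+1}$ joining it to one of $v_1,\dots,v_n$. With $\mathscr{F}_n$ the natural filtration of the process, $$P(e_{n+1}=\{v_{n+1},v_i\}\mid\mathscr{F}_n)=\frac{C_n}{d_i(n)},\quad i=1,\dots,n,\qquad C_n^{-1}=\sum_{j=1}^n\frac{1}{d_j(n)}.$$ Thus the chosen vertex's degree increases by one and $d_{n+1}(n+1)=1$. *)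

(* Defs.v *)
From mathcomp Require Import all_boot all_order all_algebra.
From mathcomp Require Import all_classical all_reals all_analysis.
Set Implicit Arguments.
Unset Strict Implicit.
Unset Printing Implicit Defensive.
Import Order.TTheory GRing.Theory Num.Theory numFieldNormedType.Exports.
Local Open Scope classical_set_scope.
Local Open Scope ring_scope.

(* A graph on the vertices v_1, ..., v_n (n = [nverts]), vertices being named
   by their indices, with a list of edges and one free half-edge. Edges are
   unordered; in the model they are stored as (newer, older). *)
Record hgraph := HGraph {
  nverts : nat;
  edges : seq (nat * nat);
  half_edge : nat }.

Definition degree (g : hgraph) (i : nat) : nat :=
  (\sum_(e <- edges g) ((e.1 == i) + (e.2 == i)) + (half_edge g == i))%N.

Definition init_graph (h : nat) : hgraph := HGraph 2 [:: (2, 1)%N] h.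

Definition attach (g : hgraph) (i : nat) : hgraph :=
  HGraph (nverts g).+1 (((nverts g).+1, i) :: edges g) (half_edge g).

(* C_n / d_i(n), where C_n^-1 is the sum of the 1 / d_j(n). *)
Definition attach_prob (R : realType) (g : hgraph) (i : nat) : R :=
  (\sum_(1 <= j < (nverts g).+1) (degree g j)%:R^-1)^-1 / (degree g i)%:R.

(* The sigma-algebra of G_2, ..., G_n; the countable type [hgraph] carries the
   discrete sigma-algebra. *)
Definition natural_filtration (T : Type) (G : nat -> T -> hgraph) (n : nat) :
    set (set T) :=
  <<s [set A | exists k (B : set hgraph),
         (2 <= k <= n)%N /\ A = G k @^-1` B] >>.

(* [f] is a version of the conditional probability P(E | F). *)
Definition is_cond_prob (d : measure_display) (T : measurableType d)
    (R : realType) (P : probability T R) (F : set (set T)) (E : set T)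
    (f : T -> R) : Prop :=
  [/\ forall B : set R, measurable B -> F (f @^-1` B),
      P.-integrable setT (EFin \o f)
    & forall A, F A -> P (A `&` E) = (\int[P]_(w in A) (f w)%:E)%E].

(* Only the values G_n with n >= 2 matter. *)
Record inverse_depreferential (d : measure_display) (T : measurableType d)
    (R : realType) (P : probability T R) (G : nat -> T -> hgraph) : Prop := {
  idp_measurable : forall n (B : set hgraph), (2 <= n)%N ->
    measurable (G n @^-1` B);
  idp_init : forall w, G 2 w = init_graph 1 \/ G 2 w = init_graph 2;
  idp_step : forall n w, (2 <= n)%N ->
    exists2 i, (1 <= i <= n)%N & G n.+1 w = attach (G n w) i;
  idp_cond : forall n i, (2 <= n)%N -> (1 <= i <= n)%N ->
    is_cond_prob P (natural_filtration G n)
      [set w | G n.+1 w = attach (G n w) i]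
      (fun w => attach_prob R (G n w) i) }.

(* Main.v *)
(** Let [S n] be the sum of the inverse degrees in [G_n], so that a vertex of
    degree [d] is chosen with probability [1 / (d * S n)].  Everything rests on
    [S n / n -> lam] almost surely.  Let [T k n] be the number of vertices
    of degree at least [k]: [T k.+1] has drift [(T k - T k.+1) / (k * S n)], and
    its martingale part is [o(n)].  Hence a bound [S n >= a n] forces
    [limsup T k n / n <= \prod_(1 <= l < k) 1 / (1 + l a)], and summing by parts
    [S n / n >= a * Phi a - o(1)] with
    [Phi a = \sum_n \prod_(1 <= l <= n) 1 / (1 + l a)].  As [Phi] is decreasing
    and [Phi lam = 1], the liminf of [S n / n] cannot lie below [lam]; all
    inequalities can be reversed, which gives the upper bound.

    For a fixed vertex, [d_i(n)^2] then has drift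
    [(2 + 1 / d_i(n)) / S n ~ 2 / (lam n)], while its martingale part has second
    moment [O(log(n)^(3/2))] and so is negligible against [log n] along
    [n = m * 2^(k^4)]; monotonicity of the degree fills the gaps.

    The edge list of a graph records its whole history, so an adapted process
    is a function of the current graph and martingale computations reduce to
    the one-step average [mean_next]. *)
Require Import Defs.
From mathcomp Require Import all_boot all_order all_algebra.
From mathcomp Require Import all_classical all_reals all_analysis.
From mathcomp Require Import measurable_realfun.
From mathcomp Require Import ring lra zify.
Import Order.TTheory GRing.Theory Num.Theory numFieldNormedType.Exports.
Set Implicit Arguments.
Unset Strict Implicit.
Unset Printing Implicit Defensive.
Local Open Scope classical_set_scope.
Local Open Scope ring_scope.

(** * Asymptotic upper bounds for real sequences *)

Section Sequences.
Context {R : realType}.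
Implicit Types (u v x g M : nat -> R) (a b c e t : R).

(** An epsilon form of an upper bound on the limsup, free of extended reals. Lower bounds on a
    liminf are stated by applying it to the negated sequence. *)
Definition limsup_le u a : Prop :=
  forall e, 0 < e -> \forall n \near \oo, u n <= a + e.

Lemma limsup_le_near u v a :
  (\forall n \near \oo, v n <= u n) -> limsup_le u a -> limsup_le v a.
Proof.
by move=> vu ua e e0; near=> n; apply: (@le_trans _ _ (u n)); near: n => //;
  exact: ua.
Unshelve. all: by end_near. Qed.

Lemma limsup_leD u v a b : limsup_le u a -> limsup_le v b ->
  limsup_le (fun n => u n + v n) (a + b).
Proof.
move=> ua vb e e0; have e2 : 0 < e / 2 by rewrite divr_gt0.
near=> n; rewrite (_ : a + b + e = (a + e / 2) + (b + e / 2)); last by lra.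
by apply: lerD; near: n; [exact: ua|exact: vb].
Unshelve. all: by end_near. Qed.

Lemma limsup_leM u a c : 0 <= c -> limsup_le u a ->
  limsup_le (fun n => c * u n) (c * a).
Proof.
move=> c0 ua e e0; have c1 : 0 < c + 1 by rewrite ltr_wpDl.
near=> n; apply: (@le_trans _ _ (c * (a + e / (c + 1)))).
  by rewrite ler_wpM2l //; near: n; apply: ua; rewrite divr_gt0.
rewrite mulrDr lerD2l mulrCA ger_pMr // ler_pdivrMr //; lra.
Unshelve. all: by end_near. Qed.

Lemma limsup_le_sum (w : nat -> R) (u : nat -> nat -> R) (a : nat -> R)
    (m K : nat) : (forall k, (m <= k < K)%N -> 0 <= w k) ->
  (forall k, (m <= k < K)%N -> limsup_le (u k) (a k)) ->
  limsup_le (fun n => \sum_(m <= k < K) w k * u k n)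
            (\sum_(m <= k < K) w k * a k).
Proof.
elim: K => [|K IHK] w0 ua.
  rewrite big_geq // => e e0; near=> n; rewrite big_geq // add0r.
  exact: ltW.
have [mK|Km] := leqP m K; last first.
  rewrite big_geq // => e e0; near=> n; rewrite big_geq // add0r.
  exact: ltW.
rewrite big_nat_recr //=.
have uK : limsup_le (u K) (a K) by apply: ua; lia.
have usum : limsup_le (fun n => \sum_(m <= k < K) w k * u k n)
    (\sum_(m <= k < K) w k * a k) by apply: IHK => k hk; [apply: w0|apply: ua]; lia.
have wK : 0 <= w K by apply: w0; lia.
apply: limsup_le_near (limsup_leD usum (limsup_leM wK uK)).
by near=> n; rewrite big_nat_recr.
Unshelve. all: by end_near. Qed.

(** The witness is the infimum of the eventual upper bounds. Its minimality is what the two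
    bootstrap arguments below contradict. *)
Lemma exists_limsup u (lb ub : R) :
  (\forall n \near \oo, lb <= u n <= ub) ->
  exists2 a, limsup_le u a &
    (lb <= a <= ub) /\ forall b, (\forall n \near \oo, u n <= b) -> a <= b.
Proof.
move=> hu; pose A := [set b | \forall n \near \oo, u n <= b].
have Aub : A ub by apply: filterS hu => n /andP[].
have Alb : lbound A lb.
  by move=> b Ab; have [n [ub_n /andP[+ _]]] := filter_ex (filterI Ab hu);
    move=> /le_trans; apply.
have hA : has_inf A by split; [exists ub|exists lb].
exists (inf A).
  move=> e e0; have [b Ab bA] := inf_adherent e0 hA.
  by move: Ab; apply: filterS => n /le_trans; apply; exact: ltW.
have infA b : A b -> inf A <= b by move=> Ab; apply: ge_inf => //; exists lb.
split; last exact: infA.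
by rewrite infA // andbT; apply: lb_le_inf => //; exists ub.
Qed.

Lemma cvg_limsup_le u a : limsup_le u a -> limsup_le (fun n => - u n) (- a) ->
  u n @[n --> \oo] --> a.
Proof.
move=> ua ua'; apply/cvgrPdist_le => e e0; near=> n.
rewrite ler_distlC; apply/andP; split.
  by near: n; apply: filterS (ua' e e0) => n; lra.
by near: n; exact: ua.
Unshelve. all: by end_near. Qed.

(* If [x] lies above the equilibrium line [y n], then its drift is at most [y];
   so after its last visit below the line it can only exceed it by the noise. *)
Lemma limsup_le_equilibrium x g M (n0 : nat) t c : 0 < c ->
  (forall n, (n0 <= n)%N -> x n.+1 <= x n + 1) ->
  (forall n, (n0 <= n)%N -> x n = x n0 + \sum_(n0 <= m < n) g m + M n) ->
  M n / n%:R @[n --> \oo] --> (0 : R) ->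
  limsup_le (fun m => g m - (t - x m / m%:R) / c) 0 ->
  limsup_le (fun n => x n / n%:R) (t / (1 + c)).
Proof.
move=> c0 xS xE M0 gle e e0; set y := t / (1 + c).
have yE : (t - y) / c = y.
  by rewrite /y; field; rewrite (gt_eqF c0) gt_eqF // addr_gt0.
have e8 : 0 < e / 8 by rewrite divr_gt0.
have [N1 _ hN1] := gle _ e8.
have /cvgrPdist_le /(_ _ e8) [N2 _ hN2] := M0.
pose N := (maxn (maxn N1 N2) n0).+1.
have M_le n : (N <= n)%N -> `|M n| <= e / 8 * n%:R.
  move=> Nn; have := hN2 n; rewrite sub0r normrN normrM normfV normr_nat /=.
  by rewrite ler_pdivrMr ?ltr0n; [apply|]; rewrite /N in Nn; lia.
(* [K] absorbs the starting height above the line at time [N], and also the overshoot when [x]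
   crosses the line in one step: at most one from [x] and [|y|] from the line. *)
pose K := `|x N - y * N%:R| + (1 + `|y|).
have K0 : 0 <= K by rewrite !addr_ge0.
(* [m] is the step just after the last time before [n] at which [x] is strictly below the line, or
   [N] if there is none. *)
have visit n : (N <= n)%N -> exists m, [/\ (N <= m <= n)%N,
    x m <= y * m%:R + K & forall j, (m <= j < n)%N -> y * j%:R <= x j].
  elim: n => [|n IHn] Nn; first by rewrite leqn0 in Nn.
  have [Nn'|nN] := leqP N n; last first.
    exists n.+1; split; [lia| |by move=> j; lia].
    have -> : n.+1 = N by lia.
    rewrite -lerBlDl; apply: le_trans (ler_norm _) _.
    by rewrite lerDl addr_ge0.
  have [yx|xy] := leP (y * n%:R) (x n); last first.
    exists n.+1; split; [lia| |by move=> j; lia].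
    apply: (le_trans (xS n _)); first by rewrite /N in Nn'; lia.
    rewrite -natr1 mulrDr mulr1.
    have : - y <= `|y| by rewrite -normrN ler_norm.
    have := normr_ge0 (x N - y * N%:R).
    by rewrite /K; lra.
  have [m [hm xm hj]] := IHn Nn'; exists m; split=> //; first by lia.
  move=> j hj'; have [->//|jn] := eqVneq j n.
  by apply: hj; lia.
(* Three errors of size [e / 8 * n] enter: the excess of the drift over [y], the noise at [n] and
   the noise at [m]. *)
have bound n : (N <= n)%N -> x n <= y * n%:R + K + e / 2 * n%:R.
  move=> Nn; have [m [hm xm hj]] := visit n Nn.
  have n0m : (n0 <= m)%N by rewrite /N in hm; lia.
  rewrite xE; last by lia.
  have xmE := xE m n0m.
  rewrite (big_cat_nat n0m) /=; last by lia.
  have gsum : \sum_(m <= j < n) g j <= (y + e / 8) * (n - m)%:R.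
    rewrite mulr_natr -sumr_const_nat big_nat [leRHS]big_nat.
    apply: ler_sum => j hmj.
    have := hN1 j; rewrite /= add0r => gj.
    have {}gj : g j - (t - x j / j%:R) / c <= e / 8.
      by apply: gj; rewrite /N in hm; lia.
    suff : (t - x j / j%:R) / c <= y by lra.
    rewrite -[leRHS]yE ler_pM2r ?invr_gt0 // lerD2l lerN2 ler_pdivlMr ?hj //.
    by rewrite ltr0n; lia.
  have Mn : M n <= e / 8 * n%:R by rewrite (le_trans (ler_norm _)) ?M_le.
  have Mm : - M m <= e / 8 * n%:R.
    rewrite (le_trans (ler_norm _)) // normrN (le_trans (M_le _ _)); [|lia|].
      by [].
    by rewrite ler_wpM2l ?ler_nat; [|exact: ltW|lia].
  have mn : (m <= n)%N by lia.
  have : e / 8 * (n - m)%:R <= e / 8 * n%:R.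
    by rewrite ler_wpM2l ?ler_nat ?leq_subr // ltW.
  have mR : 0 <= e / 8 * n%:R by rewrite mulr_ge0 // ltW.
  move: gsum; rewrite natrB // mulrBr mulrDl => gsum.
  move: xm gsum Mn Mm mR; rewrite xmE.
  lra.
near=> n.
have Nn : (N <= n)%N by near: n; exact: nbhs_infty_ge.
have n_gt0 : 0 < n%:R :> R by rewrite ltr0n; lia.
rewrite ler_pdivrMr //; apply: (le_trans (bound n Nn)).
suff : K <= e / 2 * n%:R by lra.
rewrite -ler_pdivrMl ?divr_gt0 //; near: n.
exact: nbhs_infty_ger.
Unshelve. all: by end_near. Qed.

End Sequences.

(** * The limiting degree profile *)

Section DegreeProfile.
Context {R : realType}.
Implicit Types (a b : R) (k K : nat).

(** The limiting proportion of vertices of degree at least [k] if [S n / n] tends to [a]; the terms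
    of [Phi a] are [tail_prod a k.+1]. *)
Definition tail_prod a k : R := \prod_(1 <= l < k) (1 / (1 + l%:R * a)).

Lemma tail_prod_gt0 a k : 0 < a -> 0 < tail_prod a k.
Proof.
move=> a0; apply: prodr_gt0 => l _.
by rewrite divr_gt0 // ltr_pwDl // mulr_ge0 // ltW.
Qed.

Lemma tail_prodS a k :
  tail_prod a k.+2 = tail_prod a k.+1 / (1 + k.+1%:R * a).
Proof. by rewrite /tail_prod big_nat_recr //= mul1r. Qed.

Lemma tail_prod_le a b k : 0 < a -> a <= b -> tail_prod b k <= tail_prod a k.
Proof.
move=> a0 ab; apply: ler_prod => l _.
have b0 : 0 < b by exact: lt_le_trans ab.
have pos (c : R) : 0 < c -> 0 < 1 + l%:R * c.
  by move=> c0; rewrite ltr_pwDl // mulr_ge0 // ltW.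
rewrite divr_ge0 ?(ltW (pos b b0)) //= ?mul1r lef_pV2 ?posrE ?pos //.
by rewrite lerD2l ler_wpM2l.
Qed.

Lemma tail_prod_le1 a k : 0 < a -> tail_prod a k <= 1.
Proof.
move=> a0; apply: prodr_ile1 => l _; have := mulr_ge0 (ler0n R l) (ltW a0) => la.
have l1 : 0 < 1 + l%:R * a by rewrite ltr_pwDl.
by rewrite divr_ge0 ?(ltW l1) //= ler_pdivrMr // mul1r lerDl.
Qed.

(** Strict monotonicity of [Phi] with a gap uniform in [K]: the terms at [k = 1] alone differ by
    that gap, and all later terms are ordered. *)
Lemma sum_tail_prod_le a b K : 0 < a -> a <= b -> (2 <= K)%N ->
  \sum_(1 <= k < K) tail_prod b k.+1 + (1 / (1 + a) - 1 / (1 + b))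
  <= \sum_(1 <= k < K) tail_prod a k.+1.
Proof.
move=> a0 ab K2; rewrite !(big_ltn K2) /tail_prod.
rewrite big_nat1 mul1r [X in _ <= X + _]big_nat1 !mul1r.
rewrite -subr_ge0 (_ : _ - _ = \sum_(2 <= k < K) tail_prod a k.+1
  - \sum_(2 <= k < K) tail_prod b k.+1); last by rewrite /tail_prod; ring.
by rewrite subr_ge0; apply: ler_sum => k _; exact: tail_prod_le.
Qed.

(** The weights of the summation by parts: [1 / d] is one minus the gaps of all [k] below [d]. *)
Definition inv_gap k : R := k%:R^-1 - k.+1%:R^-1.

Lemma inv_gap_ge0 k : (0 < k)%N -> 0 <= inv_gap k.
Proof.
by move=> k0; rewrite subr_ge0 lef_pV2 ?posrE ?ltr0n // ler_nat.
Qed.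

(** Summation by parts based on [tail_prodS]. The left side is the value of [S n / n] that the
    profile [tail_prod a] produces, up to truncation at [K]. Consistency with [S n / n = a]
    therefore forces [Phi a = 1]. *)
Lemma sum_inv_gap_tail_prod a K : 0 < a -> (1 <= K)%N ->
  1 - \sum_(1 <= k < K) inv_gap k * tail_prod a k.+1
  = a * \sum_(1 <= k < K) tail_prod a k.+1 + tail_prod a K / K%:R.
Proof.
move=> a0; case: K => // K _; elim: K => [|K IHK].
  by rewrite !big_geq // mulr0 subr0 add0r divr1 /tail_prod big_geq.
rewrite !(@big_nat_recr _ _ _ K.+1) //= opprD addrA IHK mulrDr -!addrA.
congr (_ + _); rewrite tail_prodS /inv_gap.
have K1 : 0 < K.+1%:R :> R by [].
have K2 : 0 < 1 + K.+1%:R * a by rewrite ltr_pwDl // mulr_ge0 // ltW.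
rewrite -[K.+2%:R]natr1; move: K.+1%:R (tail_prod a K.+1) K1 K2.
move=> x p x0 xa; field.
by rewrite (gt_eqF x0) (gt_eqF xa) /= gt_eqF // addr_gt0.
Qed.

(** * Deterministic bootstrap along one path, with [s] the weight and [t k] the tail counts *)

Context (s : nat -> R) (t : nat -> nat -> R).
Hypothesis t1 : forall n, (2 <= n)%N -> t 1%N n = n%:R.
Hypothesis tS_le : forall k n, (1 <= k)%N -> (2 <= n)%N ->
  0 <= t k.+1 n <= t k n.
Hypothesis t_step : forall k n, (2 <= n)%N ->
  t k.+2 n <= t k.+2 n.+1 <= t k.+2 n + 1.
Hypothesis s_bounds : forall n, (2 <= n)%N -> n%:R / 2 <= s n <= n%:R.
Hypothesis s_sum : forall K n, (1 <= K)%N -> (2 <= n)%N ->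
  0 <= n%:R - \sum_(1 <= k < K) inv_gap k * t k.+1 n - s n <= n%:R / K%:R.
Hypothesis t_noise : forall k, (1 <= k)%N -> exists2 M : nat -> R,
  M n / n%:R @[n --> \oo] --> (0 : R) &
  forall n, (2 <= n)%N -> t k.+1 n = t k.+1 2
    + \sum_(2 <= m < n) (t k m - t k.+1 m) / (k%:R * s m) + M n.

Let r n : R := n%:R / s n.

Let t_le k n : (2 <= n)%N -> t k.+1 n <= n%:R.
Proof.
move=> n2; elim: k => [|k IHk]; first by rewrite t1.
by have /andP[_ /le_trans] := tS_le (k := k.+1) isT n2; apply.
Qed.

Let r_bounds n : (2 <= n)%N -> 1 <= r n <= 2.
Proof.
move=> n2; have /andP[h1 h2] := s_bounds n2.
have n0 : 0 < n%:R :> R by rewrite ltr0n ltnW.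
have s0 : 0 < s n by lra.
by rewrite ler_pdivlMr // ler_pdivrMr //; apply/andP; split; lra.
Qed.

Let q_bounds k m : (2 <= m)%N ->
  0 <= t k.+1 m / m%:R - t k.+2 m / m%:R <= 1.
Proof.
move=> m2; have m0 : 0 < m%:R :> R by rewrite ltr0n ltnW.
have /andP[h1 h2] := tS_le (k := k.+1) isT m2.
rewrite -mulrBl divr_ge0 ?subr_ge0 ?(ltW m0) //= ler_pdivrMr // mul1r.
by have := t_le k m2; lra.
Qed.

Let flowE k m : (2 <= m)%N -> (t k.+1 m - t k.+2 m) / (k.+1%:R * s m)
  = (t k.+1 m / m%:R - t k.+2 m / m%:R) * r m / k.+1%:R.
Proof.
move=> m2; have m0 : 0 < m%:R :> R by rewrite ltr0n ltnW.
have s0 : 0 < s m by have /andP[h1 h2] := s_bounds m2; lra.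
rewrite /r; move: k.+1%:R (ltr0Sn R k) => c c0.
by field; rewrite (gt_eqF s0) (gt_eqF m0) (gt_eqF c0).
Qed.

(** Induction on [k]: the next tail count is driven by the current one and relaxes to the
    equilibrium slope with [c = k.+1%:R / rho], which is exactly the recursion [tail_prodS]. *)
Lemma tail_upper (rho : R) k : 0 < rho -> limsup_le r rho ->
  limsup_le (fun n => t k.+1 n / n%:R) (tail_prod rho^-1 k.+1).
Proof.
move=> rho0 r_le; elim: k => [|k IHk].
  move=> e e0; near=> n; have n2 : (2 <= n)%N by near: n; exact: nbhs_infty_ge.
  rewrite t1 // divff ?pnatr_eq0 ?lt0n_neq0 //; last by lia.
  by rewrite /tail_prod big_geq // lerDl ltW.
have [M M0 tE] := t_noise (k := k.+1) isT.
rewrite tail_prodS.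
apply: (limsup_le_equilibrium (n0 := 2) _ _ tE M0).
- by rewrite divr_gt0.
- by move=> n /(t_step k) /andP[].
(* [dl * rho + dl = e] pays for an error [dl] in the upper tail, multiplied by [rho], and an error
   [dl] in [r m], multiplied by a difference of proportions that is at most one. *)
move=> e e0; pose dl := e / (rho + 1).
have dl0 : 0 < dl by rewrite divr_gt0 // addr_gt0.
near=> m; have m2 : (2 <= m)%N by near: m; exact: nbhs_infty_ge.
rewrite flowE //.
have : r m <= rho + dl by near: m; exact: r_le.
have : t k.+1 m / m%:R <= tail_prod rho^-1 k.+1 + dl by near: m; exact: IHk.
have := q_bounds k m2; have /andP[r1 _] := r_bounds m2.
set q1 := t k.+1 m / _; set q2 := t k.+2 m / _; set p := tail_prod _ _.
move=> /andP[q0 q1'] q1p rm.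
rewrite add0r (_ : _ - _ = ((q1 - q2) * r m - (p - q2) * rho) / k.+1%:R);
  last by rewrite invfM invrK; ring.
rewrite ler_pdivrMr ?ltr0n //.
apply: (@le_trans _ _ e); last by rewrite ler_peMr ?ler1n // ltW.
have -> : e = dl * rho + dl by rewrite /dl; field; rewrite gt_eqF // addr_gt0.
have h1 : (q1 - q2) * r m <= (q1 - q2) * rho + dl.
  have : (q1 - q2) * r m <= (q1 - q2) * (rho + dl) by rewrite ler_wpM2l.
  have : (q1 - q2) * dl <= dl by rewrite ger_pMl.
  by rewrite mulrDr; lra.
have : (q1 - q2) * rho <= (p + dl - q2) * rho by rewrite ler_wpM2r ?(ltW rho0) //; lra.
by rewrite !mulrDl in h1 *; lra.
Unshelve. all: by end_near. Qed.

(** The equilibrium lemma is applied to the negated tail counts; these cannot increase, so the bound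
    on their steps is immediate. *)
Lemma tail_lower (rho : R) k : 0 < rho -> limsup_le (fun n => - r n) (- rho) ->
  limsup_le (fun n => - (t k.+1 n / n%:R)) (- tail_prod rho^-1 k.+1).
Proof.
move=> rho0 r_ge; elim: k => [|k IHk].
  move=> e e0; near=> n; have n2 : (2 <= n)%N by near: n; exact: nbhs_infty_ge.
  rewrite t1 // divff ?pnatr_eq0 ?lt0n_neq0 //; last by lia.
  by rewrite /tail_prod big_geq // lerDl ltW.
have [M M0 tE] := t_noise (k := k.+1) isT.
rewrite tail_prodS -mulNr.
have M0' : - M n / n%:R @[n --> \oo] --> (0 : R).
  apply/cvgrPdist_le => e e0; move/cvgrPdist_le : M0 => /(_ _ e0).
  by apply: filterS => n; rewrite !sub0r mulNr !normrN.
pose g m := - ((t k.+1 m - t k.+2 m) / (k.+1%:R * s m)).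
have tE' n : (2 <= n)%N -> - t k.+2 n = - t k.+2 2
    + \sum_(2 <= m < n) g m + - M n.
  by move=> n2; rewrite {1}tE // sumrN; ring.
apply: (limsup_le_near (u := fun n => - t k.+2 n / n%:R)).
  by apply: nearW => n; rewrite mulNr.
apply: (limsup_le_equilibrium (n0 := 2) _ _ tE' M0').
- by rewrite divr_gt0.
- by move=> n /(t_step k) /andP[? _]; lra.
move=> e e0; pose dl := e / (rho + 1).
have dl0 : 0 < dl by rewrite divr_gt0 // addr_gt0.
near=> m; have m2 : (2 <= m)%N by near: m; exact: nbhs_infty_ge.
rewrite /g flowE //.
have : - r m <= - rho + dl by near: m; exact: r_ge.
have : - (t k.+1 m / m%:R) <= - tail_prod rho^-1 k.+1 + dl.
  by near: m; exact: IHk.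
have := q_bounds k m2; have /andP[r1 _] := r_bounds m2.
rewrite mulNr.
set q1 := t k.+1 m / _; set q2 := t k.+2 m / _; set p := tail_prod _ _.
move=> /andP[q0 q1'] q1p rm.
rewrite add0r (_ : _ - _ = ((p - q2) * rho - (q1 - q2) * r m) / k.+1%:R);
  last by rewrite invfM invrK; ring.
rewrite ler_pdivrMr ?ltr0n //.
apply: (@le_trans _ _ e); last by rewrite ler_peMr ?ler1n // ltW.
have -> : e = dl * rho + dl by rewrite /dl; field; rewrite gt_eqF // addr_gt0.
have h1 : (q1 - q2) * rho <= (q1 - q2) * r m + dl.
  have : (q1 - q2) * rho <= (q1 - q2) * (r m + dl) by rewrite ler_wpM2l //; lra.
  have : (q1 - q2) * dl <= dl by rewrite ger_pMl.
  by rewrite mulrDr; lra.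
have : (p - dl - q2) * rho <= (q1 - q2) * rho by rewrite ler_wpM2r ?(ltW rho0) //; lra.
by rewrite !mulrDl in h1 *; lra.
Unshelve. all: by end_near. Qed.

Context (lam : R).
Hypothesis lam_gt0 : 0 < lam.
Hypothesis lam_sum :
  (fun N => \sum_(1 <= n < N) tail_prod lam n.+1) @ \oo --> (1 : R).

(** If the limsup [rho] exceeded [lam^-1], then [a = rho^-1 < lam] would make [Phi a] exceed one by
    at least [gam]. The upper tail bounds then push [S n / n] above [a * (1 + gam / 4)], so [r]
    stays below some [b < rho], against the minimality of [rho]. *)
Lemma ratio_limsup : limsup_le r lam^-1.
Proof.
have [rho r_rho [/andP[rho1 rho2] rho_min]] : exists2 rho, limsup_le r rho &
    (1 <= rho <= 2) /\ forall b, (\forall n \near \oo, r n <= b) -> rho <= b.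
  apply: exists_limsup; near=> n; apply: r_bounds.
  by near: n; exact: nbhs_infty_ge.
suff rho_lam : rho <= lam^-1.
  by move=> e e0; apply: filterS (r_rho e e0) => n /le_trans; apply; rewrite lerD2r.
have rho0 : 0 < rho by exact: lt_le_trans rho1.
rewrite leNgt; apply/negP => lam_rho; pose a := rho^-1.
have a0 : 0 < a by rewrite invr_gt0.
have a_lam : a < lam by rewrite /a -[ltRHS]invrK ltf_pV2 ?posrE ?invr_gt0.
pose gam := 1 / (1 + a) - 1 / (1 + lam).
have gam0 : 0 < gam.
  by rewrite subr_gt0 !mul1r ltf_pV2 ?posrE ?addr_gt0 // ltrD2l.
have gam4 : 0 < gam / 4 by rewrite divr_gt0.
have agam : 0 < a * (gam / 4) by rewrite mulr_gt0.
(* The gap [gam] is cut into quarters: one for truncating the series at [K], one for the error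
   [n / K] in [s_sum], one for the limsup of the tails; the last one remains in [b]. *)
have [K [K2 K_inv K_sum]] : exists K, [/\ (2 <= K)%N,
    K%:R^-1 <= a * (gam / 4) &
    1 - gam / 4 <= \sum_(1 <= k < K) tail_prod lam k.+1].
  near \oo => K; exists K; split; near: K.
  - exact: nbhs_infty_ge.
  - near=> K; rewrite -[leRHS]invrK lef_pV2 ?posrE ?invr_gt0 //.
      by near: K; exact: nbhs_infty_ger.
    by rewrite ltr0n; near: K; exact: nbhs_infty_gt.
  - move/cvgrPdist_le : lam_sum => /(_ _ gam4); apply: filterS => K.
    by rewrite ler_distlC => /andP[].
pose b := (a * (1 + gam / 4))^-1.
have b_rho : b < rho.
  rewrite -[ltRHS]invrK ltf_pV2 ?posrE ?mulr_gt0 ?addr_gt0 //.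
  by rewrite ltr_pMr // ltrDl.
suff /rho_min : \forall n \near \oo, r n <= b by rewrite leNgt b_rho.
have sum_le : limsup_le
    (fun n => \sum_(1 <= k < K) inv_gap k * (t k.+1 n / n%:R))
    (\sum_(1 <= k < K) inv_gap k * tail_prod a k.+1).
  apply: (limsup_le_sum (u := fun k n => t k.+1 n / n%:R)) => k /andP[k1 _].
    exact: inv_gap_ge0.
  exact: tail_upper.
near=> n; have n2 : (2 <= n)%N by near: n; exact: nbhs_infty_ge.
have n0 : 0 < n%:R :> R by rewrite ltr0n ltnW.
have : \sum_(1 <= k < K) inv_gap k * (t k.+1 n / n%:R) <=
  \sum_(1 <= k < K) inv_gap k * tail_prod a k.+1 + a * (gam / 4).
  by near: n; exact: (sum_le _ agam).
have /andP[_] := s_sum (ltnW K2) n2.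
have := sum_inv_gap_tail_prod a0 (ltnW K2).
have := sum_tail_prod_le a0 (ltW a_lam) K2.
have : 0 <= tail_prod a K / K%:R by rewrite divr_ge0 // ltW // tail_prod_gt0.
under [X in _ -> _ -> _ -> _ -> X <= _ -> _]eq_bigr do rewrite mulrA.
rewrite -mulr_suml -/gam; move: (\sum_(1 <= k < K) inv_gap k * t k.+1 n) => X.
move: (\sum_(1 <= k < K) inv_gap k * _) K_sum => Y.
move: (\sum_(1 <= k < K) tail_prod lam _) => L.
move: (\sum_(1 <= k < K) tail_prod _ _) (tail_prod _ _ / _) => S p.
move=> K_sum p0 hS hY hs hX.
have hs' : n%:R * (1 - X / n%:R) <= s n + n%:R / K%:R.
  rewrite (_ : _ * _ = n%:R - X); first by lra.
  by rewrite mulrBr mulr1 mulrCA divff ?mulr1 // gt_eqF.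
have : n%:R / K%:R <= n%:R * (a * (gam / 4)) by rewrite ler_wpM2l // ltW.
have aS : a * (1 + gam / 4 + gam / 2) <= a * S by rewrite ler_pM2l //; lra.
have : n%:R * (a * (1 + gam / 4) + a * (gam / 4)) <= n%:R * (1 - X / n%:R).
  rewrite ler_pM2l //; apply: le_trans (_ : 1 - Y - a * (gam / 4) <= _).
    by rewrite hY; lra.
  by lra.
move=> h1 h2.
have hsn : n%:R * (a * (1 + gam / 4)) <= s n by lra.
have s0 : 0 < s n by apply: lt_le_trans hsn; rewrite !mulr_gt0 ?addr_gt0.
rewrite /r ler_pdivrMr // mulrC ler_pdivlMr ?mulr_gt0 ?addr_gt0 //.
Unshelve. all: by end_near. Qed.

(** The mirror image, with [rho] the liminf of [r]. Here the truncation error in [s_sum] has the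
    favourable sign, and it is the boundary term [tail_prod a K / K] that must be made small. *)
Lemma ratio_liminf : limsup_le (fun n => - r n) (- lam^-1).
Proof.
have [rho' r_rho' [/andP[rho1 rho2] rho_min']] :
    exists2 rho, limsup_le (fun n => - r n) rho & (-2 <= rho <= -1) /\
      forall b, (\forall n \near \oo, - r n <= b) -> rho <= b.
  apply: exists_limsup; near=> n.
  have /r_bounds : (2 <= n)%N by near: n; exact: nbhs_infty_ge.
  by lra.
move: r_rho' rho1 rho2 rho_min'; rewrite -(opprK rho').
move: (- rho') => rho r_rho rho2 rho1 rho_min.
suff rho_lam : lam^-1 <= rho.
  by move=> e e0; apply: filterS (r_rho e e0) => n; lra.
have rho0 : 0 < rho by lra.
rewrite leNgt; apply/negP => rho_lam; pose a := rho^-1.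
have a0 : 0 < a by rewrite invr_gt0.
have lam_a : lam < a by rewrite /a -[ltLHS]invrK ltf_pV2 ?posrE ?invr_gt0.
pose gam := 1 / (1 + lam) - 1 / (1 + a).
have gam0 : 0 < gam.
  by rewrite subr_gt0 !mul1r ltf_pV2 ?posrE ?addr_gt0 // ltrD2l.
have gam1 : gam < 1.
  have : 0 < 1 / (1 + a) by rewrite divr_gt0 // addr_gt0.
  have : 1 / (1 + lam) < 1 by rewrite ltr_pdivrMr ?addr_gt0 // mul1r ltrDl.
  by rewrite /gam; lra.
have gam4 : 0 < gam / 4 by rewrite divr_gt0.
have agam : 0 < a * (gam / 4) by rewrite mulr_gt0.
have [K [K2 K_inv K_sum]] : exists K, [/\ (2 <= K)%N,
    K%:R^-1 <= a * (gam / 4) &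
    \sum_(1 <= k < K) tail_prod lam k.+1 <= 1 + gam / 4].
  near \oo => K; exists K; split; near: K.
  - exact: nbhs_infty_ge.
  - near=> K; rewrite -[leRHS]invrK lef_pV2 ?posrE ?invr_gt0 //.
      by near: K; exact: nbhs_infty_ger.
    by rewrite ltr0n; near: K; exact: nbhs_infty_gt.
  - move/cvgrPdist_le : lam_sum => /(_ _ gam4); apply: filterS => K.
    by rewrite ler_distlC => /andP[].
pose b := (a * (1 - gam / 4))^-1.
have b0 : 0 < 1 - gam / 4 by lra.
have rho_b : rho < b.
  rewrite -[ltLHS]invrK ltf_pV2 ?posrE ?mulr_gt0 //.
  by rewrite gtr_pMr //; lra.
suff /rho_min : \forall n \near \oo, - r n <= - b by lra.
have sum_le : limsup_le
    (fun n => \sum_(1 <= k < K) inv_gap k * - (t k.+1 n / n%:R))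
    (\sum_(1 <= k < K) inv_gap k * - tail_prod a k.+1).
  apply: (limsup_le_sum (u := fun k n => - (t k.+1 n / n%:R))) => k /andP[k1 _].
    exact: inv_gap_ge0.
  exact: tail_lower.
near=> n; have n2 : (2 <= n)%N by near: n; exact: nbhs_infty_ge.
have n0 : 0 < n%:R :> R by rewrite ltr0n ltnW.
have : \sum_(1 <= k < K) inv_gap k * - (t k.+1 n / n%:R) <=
  \sum_(1 <= k < K) inv_gap k * - tail_prod a k.+1 + a * (gam / 4).
  by near: n; exact: (sum_le _ agam).
have /andP[+ _] := s_sum (ltnW K2) n2.
have := sum_inv_gap_tail_prod a0 (ltnW K2).
have := sum_tail_prod_le lam_gt0 (ltW lam_a) K2.
have : tail_prod a K / K%:R <= a * (gam / 4).
  by apply: le_trans K_inv; rewrite ger_pMl ?tail_prod_le1 // invr_gt0 ltr0n ltnW.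
rewrite -/gam.
under [X in _ -> _ -> _ -> _ -> X <= _ -> _]eq_bigr do rewrite mulrN mulrA.
under [X in _ -> _ -> _ -> _ -> _ <= X + _ -> _]eq_bigr do rewrite mulrN.
rewrite !sumrN -mulr_suml.
move: (\sum_(1 <= k < K) inv_gap k * t k.+1 n) => X.
move: (\sum_(1 <= k < K) inv_gap k * _) K_sum => Y.
move: (\sum_(1 <= k < K) tail_prod lam _) => L.
move: (\sum_(1 <= k < K) tail_prod _ _) (tail_prod _ _ / _) => S p.
move=> K_sum p0 hS hY hs hX.
have hs' : s n <= n%:R * (1 - X / n%:R) .
  rewrite (_ : _ * _ = n%:R - X); first by lra.
  by rewrite mulrBr mulr1 mulrCA divff ?mulr1 // gt_eqF.
have aS : a * S <= a * (1 - gam / 4 - gam / 2) by rewrite ler_pM2l //; lra.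
have : n%:R * (1 - X / n%:R) <= n%:R * (a * (1 - gam / 4)).
  rewrite ler_pM2l //; apply: le_trans (_ : _ <= 1 - Y + a * (gam / 4)) _.
    by lra.
  by rewrite hY; lra.
move=> h1.
have hsn : s n <= n%:R * (a * (1 - gam / 4)) by lra.
have s0 : 0 < s n by have /andP[? _] := s_bounds n2; lra.
by rewrite lerN2 /r ler_pdivlMr // mulrC ler_pdivrMr ?mulr_gt0.
Unshelve. all: by end_near. Qed.

Lemma cvg_ratio : n%:R / s n @[n --> \oo] --> lam^-1.
Proof. exact: cvg_limsup_le ratio_limsup ratio_liminf. Qed.

End DegreeProfile.

(** * One step of the process *)

(** Undoes [attach]: the newest edge heads the list, so each earlier graph can be read off the
    current one. *)
Definition detach (g : hgraph) : hgraph :=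
  HGraph (nverts g).-1 (behead (edges g)) (half_edge g).

Lemma attachK (i : nat) : cancel (attach^~ i) detach.
Proof. by case. Qed.

Lemma attach_inj (g : hgraph) : injective (attach g).
Proof. by move=> i j []. Qed.

Lemma degree_attach (g : hgraph) (i j : nat) :
  degree (attach g i) j = (degree g j + (i == j) + ((nverts g).+1 == j))%N.
Proof. by rewrite /degree /= big_cons /=; lia. Qed.

Definition hgraph_code (g : hgraph) : nat :=
  pickle (nverts g, edges g, half_edge g).

Lemma hgraph_code_inj : injective hgraph_code.
Proof.
by move=> [n e h] [n' e' h'] /(pcan_inj pickleK) /= [-> -> ->].
Qed.

(** The invariants of the process. The degree sum is in fact [2 * (n - 1) + 1], from the edges and
    the half-edge; vanishing degrees beyond [n] ensure that a newcomer gets degree one. *)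
Definition regular (n : nat) (g : hgraph) : Prop :=
  [/\ nverts g = n,
      forall j, (1 <= j <= n)%N -> (0 < degree g j)%N,
      forall j, (n < j)%N -> degree g j = 0%N
    & (\sum_(1 <= j < n.+1) degree g j < n.*2)%N].

Lemma regular_init (h : nat) : (1 <= h <= 2)%N -> regular 2 (init_graph h).
Proof.
move=> hh; split=> //.
- case=> [//|[|[|//]]] _; rewrite /degree /init_graph /= big_seq1 //=.
- move=> j j2; rewrite /degree /init_graph /= big_seq1 /=.
  by move: hh j2; lia.
- rewrite /degree /init_graph /= big_nat_recr //= big_nat1 !big_seq1 /=.
  by case: h hh => [|[|[|]]].
Qed.

Lemma sum_eqn (n i : nat) :
  (1 <= i <= n)%N -> (\sum_(1 <= j < n.+1) (i == j) = 1)%N.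
Proof.
move=> hi; rewrite (bigD1_seq i) /= ?mem_index_iota ?iota_uniq // eqxx.
by rewrite big1 // => j /negPf; rewrite eq_sym => ->.
Qed.

Lemma regular_attach (n : nat) (g : hgraph) (i : nat) :
  regular n g -> (1 <= i <= n)%N -> regular n.+1 (attach g i).
Proof.
move=> [gn gpos g0 gsum] hi; split=> /=; first by rewrite gn.
- move=> j hj; rewrite degree_attach gn.
  have [jn|jn] := eqVneq j n.+1; first by lia.
  by have := gpos j; lia.
- by move=> j hj; rewrite degree_attach gn g0 ?(ltn_trans _ hj) //; lia.
- rewrite big_nat_recr //= (eq_big_nat _ _ (F2 := fun j =>
    (degree g j + (i == j))%N)); last first.
    by move=> j hj; rewrite degree_attach gn; lia.
  by rewrite big_split /= sum_eqn // degree_attach gn g0 //; lia.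
Qed.

(** * Weights, one-step means and conditional variances *)

Section Regular.
Context {R : realType}.
Implicit Types (f : hgraph -> R) (g : hgraph).

Definition weight g : R := \sum_(1 <= j < (nverts g).+1) (degree g j)%:R^-1.

Definition mean_next f g : R :=
  \sum_(1 <= i < (nverts g).+1) attach_prob R g i * f (attach g i).

Lemma attach_probE g (i : nat) :
  attach_prob R g i = ((degree g i)%:R * weight g)^-1.
Proof. by rewrite /attach_prob -/(weight g) invfM mulrC. Qed.

Lemma weight_ge0 g : 0 <= weight g.
Proof. by apply: sumr_ge0 => j _; rewrite invr_ge0. Qed.

Lemma attach_prob_ge0 g (i : nat) : 0 <= attach_prob R g i.
Proof. by rewrite attach_probE invr_ge0 mulr_ge0 // weight_ge0. Qed.

Lemma weight_le (n : nat) g : regular n g -> weight g <= n%:R.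
Proof.
move=> [gn gpos _ _]; rewrite /weight gn.
rewrite (_ : n%:R = \sum_(1 <= j < n.+1) 1); last first.
  by rewrite sumr_const_nat subn1.
rewrite big_nat [leRHS]big_nat; apply: ler_sum => j hj.
by rewrite invf_le1 ?ltr0n ?ler1n; apply: gpos; lia.
Qed.

(* Tangent line of [x |-> 1/x] at [x = 2]: the mean degree is below [2]. *)
Lemma weight_ge (n : nat) g : regular n g -> n%:R / 2 <= weight g.
Proof.
move=> [gn gpos _ gsum]; rewrite /weight gn.
have : (\sum_(1 <= j < n.+1) degree g j)%:R <= (n.*2)%:R :> R.
  by rewrite ler_nat ltnW.
rewrite natr_sum => hsum.
have : \sum_(1 <= j < n.+1) (1 - (degree g j)%:R / 4)
       <= \sum_(1 <= j < n.+1) (degree g j)%:R^-1 :> R.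
  rewrite big_nat [leRHS]big_nat; apply: ler_sum => j hj.
  have d0 : 0 < (degree g j)%:R :> R by rewrite ltr0n gpos //; lia.
  rewrite -subr_ge0 (_ : _ - _ = ((degree g j)%:R - 2) ^+ 2
    / (4 * (degree g j)%:R)); last by field; rewrite gt_eqF.
  by rewrite divr_ge0 ?sqr_ge0 // mulr_ge0 // ltW.
apply: le_trans; rewrite sumrB sumr_const_nat subn1 /= -mulr_suml.
by rewrite -muln2 natrM in hsum; rewrite -mulr_natl; lra.
Qed.

Lemma weight_gt0 (n : nat) g : (0 < n)%N -> regular n g -> 0 < weight g.
Proof.
by move=> n0 /weight_ge; apply: lt_le_trans; rewrite divr_gt0 // ltr0n.
Qed.

Lemma sum_attach_prob (n : nat) g : (0 < n)%N -> regular n g ->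
  \sum_(1 <= i < (nverts g).+1) attach_prob R g i = 1.
Proof.
move=> n0 gr; rewrite /attach_prob -mulr_sumr mulVf //.
by rewrite gt_eqF // -/(weight g) (weight_gt0 n0 gr).
Qed.

Lemma mean_next_ge0 f g : (forall h, 0 <= f h) -> 0 <= mean_next f g.
Proof.
by move=> f0; apply: sumr_ge0 => i _; rewrite mulr_ge0 ?attach_prob_ge0.
Qed.

Lemma mean_nextE (n : nat) f (f' : nat -> R) g : regular n g ->
  (forall i, (1 <= i <= n)%N -> f (attach g i) = f' i) ->
  mean_next f g = \sum_(1 <= i < n.+1) attach_prob R g i * f' i.
Proof.
move=> [gn _ _ _] ff'; rewrite /mean_next gn; apply: eq_big_nat => i hi.
by rewrite ff' //; lia.
Qed.

Lemma mean_next_le (n : nat) f (c : R) g : (0 < n)%N -> regular n g ->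
  (forall i, (1 <= i <= n)%N -> f (attach g i) <= c) -> mean_next f g <= c.
Proof.
move=> n0 gr fc; rewrite -[leRHS]mul1r -(sum_attach_prob n0 gr) mulr_suml.
case: gr => gn _ _ _; rewrite /mean_next gn big_nat [leRHS]big_nat.
by apply: ler_sum => i hi; rewrite ler_wpM2l ?attach_prob_ge0 ?fc //; lia.
Qed.

Definition drift f g : R := mean_next f g - f g.

(* Conditional variance of [f] over one step of the process. *)
Definition spread f g : R :=
  mean_next (fun h => (f h - mean_next f g) ^+ 2) g.

Lemma spread_ge0 f g : 0 <= spread f g.
Proof. by apply: mean_next_ge0 => h; exact: sqr_ge0. Qed.

(** The cross term vanishes because [f] minus its one-step mean has mean zero. With [c] a drift this
    bounds the variance; with [c] a martingale value it gives orthogonality of increments. *)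
Lemma mean_next_shift_sqr (n : nat) f (c : R) g : (0 < n)%N -> regular n g ->
  mean_next (fun h => (c + (f h - mean_next f g)) ^+ 2) g
  = c ^+ 2 + spread f g.
Proof.
move=> n0 gr; have p1 := sum_attach_prob n0 gr.
rewrite /spread; set mu := mean_next f g.
have -> : mean_next (fun h => (c + (f h - mu)) ^+ 2) g =
  c ^+ 2 * (\sum_(1 <= i < (nverts g).+1) attach_prob R g i)
  + 2 * c * (mean_next f g
             - mu * (\sum_(1 <= i < (nverts g).+1) attach_prob R g i))
  + mean_next (fun h => (f h - mu) ^+ 2) g.
  rewrite /mean_next !mulr_sumr -sumrB mulr_sumr -!big_split /=.
  by apply: eq_bigr => i _; ring.
by rewrite p1 /mu !mulr1 subrr mulr0 addr0.
Qed.

Lemma spread_le (n : nat) f g : (0 < n)%N -> regular n g ->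
  spread f g <= mean_next (fun h => (f h - f g) ^+ 2) g.
Proof.
move=> n0 gr; rewrite (_ : (fun h => (f h - f g) ^+ 2) =
  fun h => (drift f g + (f h - mean_next f g)) ^+ 2); last first.
  by apply/funext => h; rewrite /drift; congr (_ ^+ 2); ring.
by rewrite (mean_next_shift_sqr _ _ n0 gr) lerDr sqr_ge0.
Qed.

(** The martingale part of the Doob decomposition of [f] over the last [k] steps, computed backwards
    from the current graph. *)
Fixpoint martingale f (k : nat) g : R :=
  if k is k'.+1 then
    martingale f k' (detach g) + (f g - mean_next f (detach g))
  else 0.

Lemma martingale_sqr_next (n k : nat) f g : (0 < n)%N -> regular n g ->
  mean_next (fun h => martingale f k.+1 h ^+ 2) g
  = martingale f k g ^+ 2 + spread f g.
Proof.
move=> n0 gr; rewrite -(mean_next_shift_sqr _ _ n0 gr) /=.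
by apply: eq_bigr => i _; rewrite attachK.
Qed.

End Regular.

(** * Martingales along the process *)

Section Process.
Context {d : measure_display} {T : measurableType d} {R : realType}
        {P : probability T R} {G : nat -> T -> hgraph}.
Hypothesis hG : inverse_depreferential P G.

Lemma regular_process (n : nat) (w : T) : (2 <= n)%N -> regular n (G n w).
Proof.
case: n => [//|[//|n]] _; elim: n => [|n IHn].
  by case: (idp_init hG w) => ->; exact: regular_init.
have [i hi ->] := @idp_step _ _ _ _ _ hG n.+2 w isT.
exact: regular_attach.
Qed.

Lemma detach_process (n : nat) (w : T) :
  (2 <= n)%N -> detach (G n.+1 w) = G n w.
Proof. by move=> n2; have [i _ ->] := idp_step hG w n2; rewrite attachK. Qed.

Lemma measurable_process (n : nat) (f : hgraph -> R) : (2 <= n)%N ->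
  measurable_fun setT (fun w => f (G n w)).
Proof.
move=> n2 _ B mB; rewrite setTI.
exact: (idp_measurable hG (f @^-1` B) n2).
Qed.

Lemma measurable_attach (n i : nat) : (2 <= n)%N ->
  measurable [set w | G n.+1 w = attach (G n w) i].
Proof.
move=> n2; rewrite (_ : mkset _ =
    G n.+1 @^-1` [set h | h = attach (detach h) i]).
  by apply: (idp_measurable hG); lia.
by apply/seteqP; split=> w /=; rewrite detach_process.
Qed.

(* Conditioning on [G_n]: split along the countably many values of [G_n]. *)
Lemma integral_attach (n i : nat) (f : hgraph -> R) :
  (2 <= n)%N -> (1 <= i <= n)%N -> (forall g, 0 <= f g) ->
  (\int[P]_w (f (G n w) * \1_[set w | G n.+1 w = attach (G n w) i] w)%:E
   = \int[P]_w (f (G n w) * attach_prob R (G n w) i)%:E)%E.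
Proof.
move=> n2 hi f0; set E := [set w | _].
have mE : measurable E := measurable_attach i n2.
pose A k := G n @^-1` [set g | hgraph_code g = k].
have mA k : measurable (A k) by exact: (idp_measurable hG).
have AT : \bigcup_k A k = setT.
  by rewrite -subTset => w _; exists (hgraph_code (G n w)).
have tA : trivIset setT A.
  apply/trivIsetP => j k _ _ /eqP jk; apply/seteqP; split=> // w [/= jw kw].
  by apply: jk; rewrite -jw -kw.
have mf1 : measurable_fun setT (fun w => (f (G n w) * \1_E w)%:E : \bar R).
  apply/measurable_EFinP; apply: measurable_funM; last exact: measurable_indic.
  exact: measurable_process.
have mf2 : measurable_fun setT
    (fun w => (f (G n w) * attach_prob R (G n w) i)%:E : \bar R).
  apply/measurable_EFinP.
  exact: (measurable_process (fun g => f g * attach_prob R g i)).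
rewrite -AT !ge0_integral_bigcup //= ?AT //; last 2 first.
- by move=> w _; rewrite lee_fin mulr_ge0 // attach_prob_ge0.
- by move=> w _; rewrite lee_fin mulr_ge0.
apply: eq_eseriesr => k _.
have [->|/set0P[w0 Aw0]] := eqVneq (A k) set0; first by rewrite !integral_set0.
have fA w : A k w -> f (G n w) = f (G n w0).
  by move=> Aw; congr f; apply: hgraph_code_inj; rewrite [LHS]Aw [RHS]Aw0.
have [_ _ /(_ (A k)) cond] := idp_cond hG n2 hi.
under eq_integral => w /set_mem /fA -> do rewrite EFinM.
under [RHS]eq_integral => w /set_mem /fA -> do rewrite EFinM.
rewrite !ge0_integralZl ?lee_fin //; last 3 first.
- apply/measurable_EFinP; apply: measurable_funTS.
  exact: (measurable_process (fun g => attach_prob R g i)).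
- by move=> w _; rewrite lee_fin attach_prob_ge0.
- by apply/measurable_EFinP; apply: measurable_funTS; exact: measurable_indic.
rewrite integral_indic // (setIC E); congr (_ * _)%E; apply: cond.
apply: sub_gen_smallest; exists n, [set g | hgraph_code g = k].
by rewrite n2 leqnn.
Qed.

(** The tower property. The integrand is split according to the vertex receiving the new edge; by
    [attach_inj] exactly one indicator is nonzero. *)
Lemma integral_process_next (n : nat) (f : hgraph -> R) :
  (2 <= n)%N -> (forall g, 0 <= f g) ->
  (\int[P]_w (f (G n.+1 w))%:E = \int[P]_w (mean_next f (G n w))%:E)%E.
Proof.
move=> n2 f0.
pose E i := [set w | G n.+1 w = attach (G n w) i].
transitivity (\int[P]_w (\sum_(1 <= i < n.+1)
    (f (attach (G n w) i) * \1_(E i) w)%:E))%E.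
  apply: eq_integral => w _; have [i hi Gw] := idp_step hG w n2.
  rewrite sumEFin (bigD1_seq i) /= ?mem_index_iota ?iota_uniq //.
  rewrite big1 ?addr0 => [|j ji].
    by rewrite indicE mem_set ?mulr1 -?Gw.
  rewrite indicE memNset ?mulr0 // /E /= Gw => /attach_inj ij.
  by rewrite ij eqxx in ji.
rewrite ge0_integral_sum //; last 2 first.
- move=> i; apply/measurable_EFinP; apply: measurable_funM.
    exact: (measurable_process (fun g => f (attach g i))).
  exact/measurable_indic/measurable_attach.
- by move=> i w _; rewrite lee_fin mulr_ge0.
rewrite [RHS](_ : _ = \int[P]_w (\sum_(1 <= i < n.+1)
    (f (attach (G n w) i) * attach_prob R (G n w) i)%:E))%E; last first.
  apply: eq_integral => w _; rewrite sumEFin /mean_next.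
  have [-> _ _ _] := regular_process w n2.
  by congr _%:E; apply: eq_bigr => i _; rewrite mulrC.
rewrite ge0_integral_sum //; last 2 first.
- move=> i; apply/measurable_EFinP.
  exact: (measurable_process (fun g => f (attach g i) * attach_prob R g i)).
- by move=> i w _; rewrite lee_fin mulr_ge0 ?attach_prob_ge0.
apply: eq_big_nat => i hi.
by apply: (integral_attach (f := fun g => f (attach g i))) => //; lia.
Qed.

Lemma martingaleE (f : hgraph -> R) (m k : nat) (w : T) : (2 <= m)%N ->
  martingale f k (G (m + k) w)
  = f (G (m + k) w) - f (G m w) - \sum_(m <= j < m + k) drift f (G j w).
Proof.
move=> m2; elim: k => [|k IHk].
  by rewrite addn0 big_geq //= !subrr.
rewrite addnS /= detach_process ?(leq_trans m2) ?leq_addr // IHk.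
by rewrite big_nat_recr ?leq_addr //= /drift; ring.
Qed.

(** Orthogonal increments: the martingale starts at zero, and each step adds the expected spread to
    its second moment. *)
Lemma integral_martingale_sqr (f : hgraph -> R) (m k : nat) (V : nat -> R) :
  (2 <= m)%N ->
  (forall j, (j < k)%N ->
     (\int[P]_w (spread f (G (m + j) w))%:E <= (V j)%:E)%E) ->
  (\int[P]_w (martingale f k (G (m + k) w) ^+ 2)%:E
   <= (\sum_(0 <= j < k) V j)%:E)%E.
Proof.
move=> m2; elim: k => [|k IHk] hV.
  by rewrite big_geq //= expr0n /= integral0.
have mk2 : (2 <= m + k)%N by rewrite (leq_trans m2) ?leq_addr.
rewrite addnS (@integral_process_next _ (fun h => martingale f k.+1 h ^+ 2)) //;
  last by move=> g; exact: sqr_ge0.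
under eq_integral => w _.
  rewrite (@martingale_sqr_next _ (m + k)) ?EFinD; last 2 first.
  - exact: ltnW.
  - exact: regular_process.
  over.
rewrite ge0_integralD //; last 4 first.
- by move=> w _; rewrite lee_fin sqr_ge0.
- apply/measurable_EFinP.
  exact: (measurable_process (fun g => martingale f k g ^+ 2)).
- by move=> w _; rewrite lee_fin spread_ge0.
- exact/measurable_EFinP/measurable_process.
rewrite big_nat_recr //= EFinD leeD ?hV // IHk // => j jk.
by apply: hV; lia.
Qed.

Lemma integral_cst_probability (c : \bar R) : (\int[P]_w cst c w = c)%E.
Proof.
rewrite integral_cst //; transitivity (c * P setT)%E => //.
by rewrite probability_setT mule1.
Qed.

(** The second moments are summable, so the series of squares is integrable, hence almost surely
    finite, and its terms tend to zero. *)
Lemma ae_cvg0_of_sqr (Z : nat -> T -> R) (C : R) :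
  (forall k, measurable_fun setT (Z k)) ->
  (forall k, \int[P]_w (Z k w ^+ 2)%:E <= (C / k.+1%:R ^+ 2)%:E)%E ->
  {ae P, forall w, Z k w @[k --> \oo] --> (0 : R)}.
Proof.
move=> mZ ZC.
have mZ2 k : measurable_fun setT (fun w => (Z k w ^+ 2)%:E : \bar R).
  by apply/measurable_EFinP; exact: measurable_funX.
pose S w := (\sum_(0 <= k <oo) (Z k w ^+ 2)%:E)%E.
have S0 w : (0 <= S w)%E.
  by apply: nneseries_ge0 => k _ _; rewrite lee_fin sqr_ge0.
have C0 : 0 <= C.
  rewrite -lee_fin; have := ZC 0%N; rewrite expr1n divr1; apply: le_trans.
  by apply: integral_ge0 => w _; rewrite lee_fin sqr_ge0.
have Sint : (\int[P]_w S w < +oo)%E.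
  rewrite integral_nneseries //; last by move=> k w _; rewrite lee_fin sqr_ge0.
  apply: (@le_lt_trans _ _ (C * 2)%:E); last exact: ltry.
  apply: lime_le.
    apply: is_cvg_nneseries => k _ _.
    by apply: integral_ge0 => w _; rewrite lee_fin sqr_ge0.
  apply: nearW => n.
  apply: (@le_trans _ _ (\sum_(0 <= k < n) (C / k.+1%:R ^+ 2)%:E)%E).
    by apply: lee_sum => k _; exact: ZC.
  rewrite sumEFin lee_fin -mulr_sumr ler_wpM2l //.
  case: n => [|n]; first by rewrite big_geq.
  (* The term [- n.+1%:R^-1] strengthens the bound so that the induction telescopes. *)
  suff : \sum_(0 <= k < n.+1) (k.+1%:R ^+ 2)^-1 <= 2 - n.+1%:R^-1 :> R.
    by move=> /le_trans; apply; rewrite gerBl invr_ge0.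
  elim: n => [|n IHn]; first by rewrite big_nat1 expr1n invr1; lra.
  rewrite big_nat_recr //=; apply: (le_trans (lerD IHn (lexx _))).
  rewrite -subr_ge0 (_ : _ - _ = (n.+1%:R * n.+2%:R ^+ 2)^-1).
    by rewrite invr_ge0 mulr_ge0 ?sqr_ge0.
  have n1 : n.+1%:R != 0 :> R by rewrite pnatr_eq0.
  have n2 : n.+2%:R != 0 :> R by rewrite pnatr_eq0.
  move: n1 n2; rewrite -[n.+2%:R]natr1; set x := n.+1%:R => n1 n2.
  by field; rewrite [1 + _]addrC !natr1 !pnatr_eq0.
have /integrable_ae : P.-integrable setT S.
  apply/integrableP; split.
    by apply: ge0_emeasurable_sum => // k w _ _; rewrite lee_fin sqr_ge0.
  by under eq_integral do rewrite gee0_abs //.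
move=> /(_ measurableT); apply: filterS => w /(_ I) Sw.
have /cvg_series_cvg_0 Z0 : cvgn (series (fun k => Z k w ^+ 2)).
  apply: nnseries_is_cvg => [k|]; first exact: sqr_ge0.
  by have := Sw; rewrite fin_numElt => /andP[].
apply/cvgrPdist_lt => e e0.
have /cvgrPdist_lt /(_ (e ^+ 2)) := Z0; rewrite exprn_gt0 // => /(_ isT).
apply: filterS => k; rewrite !sub0r !normrN normrX.
by rewrite ltr_pXn2r // nnegrE // ltW.
Qed.

End Process.

(** * Convergence of the mean inverse degree *)

Section TailCounts.
Context {R : realType}.
Implicit Types (g : hgraph) (k n i : nat).

Definition tail_count k g : R :=
  \sum_(1 <= j < (nverts g).+1) (k <= degree g j)%N%:R.

Lemma tail_count1 n g : regular n g -> tail_count 1 g = n%:R.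
Proof.
move=> [gn gpos _ _]; rewrite /tail_count gn.
rewrite (eq_big_nat _ _ (F2 := fun=> 1)); last first.
  by move=> j hj; rewrite gpos //; lia.
by rewrite sumr_const_nat subn1.
Qed.

Lemma tail_countS_le k g : 0 <= tail_count k.+1 g <= tail_count k g.
Proof.
rewrite sumr_ge0 //=; apply: ler_sum => j _; rewrite ler_nat.
by case: ltnP => // /ltnW ->.
Qed.

(** The threshold is at least two, so the newcomer of degree one is not counted; only a chosen
    vertex of degree exactly [k.+1] crosses it. *)
Lemma tail_count_attach n k g i : regular n g -> (1 <= i <= n)%N ->
  tail_count k.+2 (attach g i) = tail_count k.+2 g + (degree g i == k.+1)%:R.
Proof.
move=> [gn _ g0 _] hi; rewrite /tail_count /= gn big_nat_recr //=.
rewrite degree_attach gn g0 // (_ : (_ <= _)%N = false) ?addr0; last by lia.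
transitivity (\sum_(1 <= j < n.+1) ((k.+2 <= degree g j)%N%:R
    + (i == j)%:R * (degree g i == k.+1)%:R) : R).
  apply: eq_big_nat => j hj; rewrite degree_attach gn -natrM -natrD.
  by congr _%:R; case: (eqVneq i j) => [<-|]; lia.
have eq1 : \sum_(1 <= j < n.+1) (i == j)%:R = 1 :> R.
  by rewrite -natr_sum sum_eqn.
by rewrite big_split /= -mulr_suml eq1 mul1r.
Qed.

Lemma tail_count_step n k g i : regular n g -> (1 <= i <= n)%N ->
  tail_count k.+2 g <= tail_count k.+2 (attach g i) <= tail_count k.+2 g + 1.
Proof.
move=> gr hi; rewrite (tail_count_attach _ gr hi) lerDl lerD2l ler0n /=.
by rewrite lern1 leq_b1.
Qed.

(** The difference of tail counts is the number of vertices of degree exactly [k.+1], each chosen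
    with probability [1 / (k.+1 * weight g)]. *)
Lemma drift_tail_count n k g : (0 < n)%N -> regular n g ->
  drift (tail_count k.+2) g
  = (tail_count k.+1 g - tail_count k.+2 g) / (k.+1%:R * weight g).
Proof.
move=> n0 gr; have gw := gr; case: gw => gn gpos _ _.
rewrite /drift (mean_nextE gr (fun i hi => tail_count_attach k gr hi)).
under eq_bigr do rewrite mulrDr.
rewrite big_split /= -mulr_suml -{1}gn (sum_attach_prob n0 gr) mul1r.
rewrite [X in X - _]addrC addrK.
rewrite /tail_count gn -sumrB mulr_suml; apply: eq_big_nat => i hi.
rewrite attach_probE; have [->|dk] := eqVneq (degree g i) k.+1.
  by rewrite leqnn ltnn subr0 mulr1 mul1r.
rewrite mulr0 (_ : (k.+2 <= _)%N = (k.+1 <= degree g i)%N) ?subrr ?mul0r //.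
by move/eqP: dk; lia.
Qed.

Lemma inv_minn_degree k (dg : nat) : (0 < dg)%N -> (0 < k)%N ->
  1 - \sum_(1 <= l < k) inv_gap l * (l.+1 <= dg)%N%:R
  = (minn dg k)%:R^-1 :> R.
Proof.
move=> d0; case: k => // k _; elim: k => [|k IHk].
  by rewrite big_geq // subr0 (minn_idPr d0) invr1.
rewrite big_nat_recr //= opprD addrA IHk.
have [kd|dk] := ltnP k.+1 dg.
  by rewrite mulr1 (minn_idPr kd) /inv_gap; ring.
by rewrite mulr0 subr0 (minn_idPl (leqW dk)).
Qed.

(** By [inv_minn_degree] the truncated sum replaces each degree by its minimum with [K], which
    alters the inverse by at most [1 / K] per vertex. *)
Lemma weight_tail_count n K g : regular n g -> (1 <= K)%N ->
  0 <= n%:R - \sum_(1 <= k < K) inv_gap k * tail_count k.+1 g - weight g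
    <= n%:R / K%:R.
Proof.
move=> [gn gpos _ _] K1.
rewrite (_ : n%:R - _ - _ = \sum_(1 <= j < n.+1)
    ((minn (degree g j) K)%:R^-1 - (degree g j)%:R^-1)); last first.
  rewrite sumrB /weight gn; congr (_ - _).
  transitivity (\sum_(1 <= j < n.+1)
    (1 - \sum_(1 <= k < K) inv_gap k * (k.+1 <= degree g j)%N%:R) : R).
    rewrite sumrB sumr_const_nat subn1; congr (_ - _).
    rewrite exchange_big /=; apply: eq_bigr => k _.
    by rewrite -mulr_sumr /tail_count gn.
  by apply: eq_big_nat => j hj; rewrite inv_minn_degree // gpos; lia.
have bounds j : (1 <= j < n.+1)%N ->
  0 <= (minn (degree g j) K)%:R^-1 - (degree g j)%:R^-1 :> R /\
  (minn (degree g j) K)%:R^-1 - (degree g j)%:R^-1 <= K%:R^-1 :> R.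
  move=> hj; have d0 : (0 < degree g j)%N by apply: gpos; lia.
  have [dK|Kd] := leqP (degree g j) K.
    by rewrite subrr lexx invr_ge0.
  rewrite subr_ge0 lef_pV2 ?posrE ?ltr0n // ler_nat ltnW //.
  by rewrite gerBl invr_ge0.
apply/andP; split.
  by rewrite big_nat; apply: sumr_ge0 => j /bounds [].
rewrite (_ : n%:R / K%:R = \sum_(1 <= j < n.+1) K%:R^-1); last first.
  by rewrite sumr_const_nat subn1 mulr_natl.
by rewrite big_nat [leRHS]big_nat; apply: ler_sum => j /bounds [].
Qed.

End TailCounts.

(** * From the squares to all times *)

Section LawOfLargeNumbers.
Context {R : realType}.

Lemma exists_nat_sqrt (n : nat) : exists k, (k ^ 2 <= n < k.+1 ^ 2)%N.
Proof.
elim: n => [|n [k hk]]; first by exists 0%N.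
have [nk|kn] := ltnP n.+1 (k.+1 ^ 2); first by exists k; lia.
by exists k.+1; nia.
Qed.

(** A time [n] exceeds the last square [k.+1 ^ 2] by at most [2 * k.+1], which is negligible against
    [n]; unit increments then control the difference. *)
Lemma cvg0_along_squares (m : nat -> R) :
  (forall n, `|m n.+1 - m n| <= 1) ->
  m (k.+1 ^ 2)%N / k.+1%:R ^+ 2 @[k --> \oo] --> (0 : R) ->
  m n / n%:R @[n --> \oo] --> (0 : R).
Proof.
move=> mS m0; apply/cvgrPdist_le => e e0.
have e2 : 0 < e / 2 by rewrite divr_gt0.
have e4 : 0 < e / 4 by rewrite divr_gt0.
have m_lip a b : `|m (a + b)%N - m a| <= b%:R.
  elim: b => [|b IHb]; first by rewrite addn0 subrr normr0.
  rewrite addnS -natr1 (_ : _ - _ = m (a + b)%N - m a +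
    (m (a + b).+1 - m (a + b)%N)); last by ring.
  by rewrite (le_trans (ler_normD _ _)) // lerD.
have [N1 _ hN1] : \forall k \near \oo, `|m (k.+1 ^ 2)%N / k.+1%:R ^+ 2| <= e / 2.
  by move/cvgrPdist_le : m0 => /(_ _ e2); apply: filterS => k;
    rewrite sub0r normrN.
have [N2 _ hN2] : \forall k \near \oo, (e / 4)^-1 <= k%:R.
  exact: nbhs_infty_ger.
exists ((maxn N1.+1 N2).+1 ^ 2)%N => // n /= hn.
have [k hk] := exists_nat_sqrt n.
have kN : (maxn N1.+1 N2 < k.+1)%N.
  by rewrite -(ltn_exp2r _ _ (isT : (0 < 2)%N)); case/andP: hk => _; apply: leq_ltn_trans;
     apply: leq_trans hn; rewrite leq_exp2r.
case: k hk kN => [|k] hk kN; first by lia.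
have n0 : 0 < n%:R :> R by rewrite ltr0n; lia.
have k0 : 0 < k.+1%:R :> R by [].
rewrite sub0r normrN normrM normfV normr_nat ler_pdivrMr //.
have nE : n = (k.+1 ^ 2 + (n - k.+1 ^ 2))%N by lia.
have kn : k.+1%:R ^+ 2 <= n%:R :> R by rewrite -natrX ler_nat; lia.
have := m_lip (k.+1 ^ 2)%N (n - k.+1 ^ 2)%N; rewrite -nE => mn.
have : (n - k.+1 ^ 2)%:R <= 2 * k.+1%:R :> R.
  by rewrite -natrM ler_nat; nia.
have : k.+1%:R <= e / 4 * n%:R.
  have : (e / 4)^-1 <= k.+1%:R by apply: hN2 => /=; lia.
  rewrite -ler_pdivrMl // => h; apply: le_trans kn.
  by rewrite expr2 ler_pM2r.
have : `|m (k.+1 ^ 2)%N| <= e / 2 * n%:R.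
  have := hN1 k; rewrite normrM normfV (ger0_norm (sqr_ge0 _)) => h.
  apply: le_trans (_ : e / 2 * k.+1%:R ^+ 2 <= _); last by rewrite ler_pM2l.
  by rewrite -ler_pdivrMr ?exprn_gt0 //; apply: h => /=; lia.
have := ler_normD (m n - m (k.+1 ^ 2)%N) (m (k.+1 ^ 2)%N); rewrite subrK.
by lra.
Qed.

End LawOfLargeNumbers.

(** * Strong law for the martingale parts, and the limit of the weight *)

Section UnitSteps.
Context {d : measure_display} {T : measurableType d} {R : realType}
        {P : probability T R} {G : nat -> T -> hgraph}.
Hypothesis hG : inverse_depreferential P G.

Lemma integral_scaled_martingale_sqr (f : hgraph -> R) (c : R) (m k : nat) :
  (2 <= m)%N ->
  (\int[P]_w ((c * martingale f k (G (m + k) w)) ^+ 2)%:E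
   = (c ^+ 2)%:E * \int[P]_w (martingale f k (G (m + k) w) ^+ 2)%:E)%E.
Proof.
move=> m2; under eq_integral => w _ do rewrite exprMn EFinM.
rewrite ge0_integralZl ?lee_fin ?sqr_ge0 //.
  apply/measurable_EFinP.
  apply: (measurable_process hG (fun g => martingale f k g ^+ 2)).
  by rewrite (leq_trans m2) ?leq_addr.
by move=> w _; rewrite lee_fin sqr_ge0.
Qed.

Definition unit_step (f : hgraph -> R) : Prop :=
  forall n g i, (2 <= n)%N -> regular n g -> (1 <= i <= n)%N ->
    f g <= f (attach g i) <= f g + 1.

Lemma unit_step_mean_next (f : hgraph -> R) (n : nat) (g : hgraph) :
  unit_step f -> (2 <= n)%N -> regular n g ->
  f g <= mean_next f g <= f g + 1.
Proof.
move=> fS n2 gr; have n0 : (0 < n)%N by exact: ltnW.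
apply/andP; split.
  rewrite -[leLHS]mul1r -(sum_attach_prob n0 gr) mulr_suml.
  case: (gr) => gn _ _ _; rewrite /mean_next gn big_nat [leRHS]big_nat.
  apply: ler_sum => i hi; rewrite ler_wpM2l ?attach_prob_ge0 //.
  by have /andP[] := fS n g i n2 gr hi.
apply: (mean_next_le n0 gr) => i hi.
by have /andP[] := fS n g i n2 gr hi.
Qed.

(** The spread is at most one, so the second moment after [q ^ 2] steps is at most [q ^ 2]; dividing
    by [q ^ 4] leaves the summable [1 / q ^ 2]. *)
Lemma ae_martingale_cvg0 (f : hgraph -> R) : unit_step f ->
  {ae P, forall w, martingale f n (G (2 + n) w) / n%:R @[n --> \oo] --> (0 : R)}.
Proof.
move=> fS.
have incr n w : `|martingale f n.+1 (G (2 + n.+1) w)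
                 - martingale f n (G (2 + n) w)| <= 1.
  rewrite addnS /= (detach_process hG) // addrC addKr.
  have [i hi ->] := idp_step hG w (isT : (2 <= n.+2)%N).
  have gr := regular_process hG w (isT : (2 <= n.+2)%N).
  have /andP[h1 h2] := @unit_step_mean_next f n.+2 _ fS isT gr.
  have /andP[h3 h4] := fS n.+2 _ _ isT gr hi.
  by rewrite ler_norml; apply/andP; split; lra.
pose Z k w := (k.+1%:R ^+ 2)^-1
  * martingale f (k.+1 ^ 2)%N (G (2 + k.+1 ^ 2)%N w).
have mZ k : measurable_fun setT (Z k).
  exact: (measurable_process hG
    (fun g => (k.+1%:R ^+ 2)^-1 * martingale f (k.+1 ^ 2)%N g)).
have intZ k : (\int[P]_w (Z k w ^+ 2)%:E <= (1 / k.+1%:R ^+ 2)%:E)%E.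
  rewrite integral_scaled_martingale_sqr //.
  apply: (@le_trans _ _ (((k.+1%:R ^+ 2)^-1 ^+ 2)%:E
      * (\sum_(0 <= j < k.+1 ^ 2) 1)%:E)%E).
    apply: lee_wpmul2l; first by rewrite lee_fin sqr_ge0.
    apply: (integral_martingale_sqr hG (V := fun=> 1)) => // j _.
    rewrite -[leRHS](integral_cst_probability (P := P)).
    apply: ge0_le_integral => //.
    - by move=> w _; rewrite lee_fin spread_ge0.
    - exact/measurable_EFinP/(measurable_process hG).
    move=> w _; rewrite lee_fin.
    have gr := regular_process hG w (isT : (2 <= j.+2)%N).
    apply: (le_trans (@spread_le _ j.+2 _ _ isT gr)); apply: (@mean_next_le _ j.+2 _ _ _ isT gr) => i hi.
    have /andP[h3 h4] := fS j.+2 _ _ isT gr hi.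
    by rewrite expr_le1 //; lra.
  rewrite -EFinM lee_fin sumr_const_nat subn0 natrX mul1r.
  by rewrite expr2 -mulrA mulVf ?mulr1 // expf_neq0.
have := ae_cvg0_of_sqr mZ intZ; apply: filterS => w Zw.
apply: (cvg0_along_squares (m := fun n => martingale f n (G (2 + n) w))) => //.
by under eq_cvg do rewrite mulrC.
Qed.

Lemma ae_cvg_ratio_weight (lam : R) : 0 < lam ->
  (fun N => \sum_(1 <= n < N) tail_prod lam n.+1) @ \oo --> (1 : R) ->
  {ae P, forall w, n%:R / weight (G n w) @[n --> \oo] --> lam^-1}.
Proof.
move=> lam0 lam_sum.
have := ae_foralln (fun k => ae_martingale_cvg0
  (fun n g i n2 gr hi => tail_count_step k gr hi)).
apply: filterS => w Mw.
apply: (cvg_ratio (t := fun k n => tail_count k (G n w))) => //.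
- by move=> n n2; rewrite (tail_count1 (regular_process hG w n2)).
- by move=> k n _ _; exact: tail_countS_le.
- move=> k n n2; have [i hi ->] := idp_step hG w n2.
  exact: (tail_count_step _ (regular_process hG w n2)).
- move=> n n2; have gr := regular_process hG w n2.
  by rewrite weight_ge ?weight_le.
- by move=> K n K1 n2; exact: (weight_tail_count (regular_process hG w n2)).
case=> [//|k] _.
(* The martingale counts its steps from time two; dividing by [n] rather than [n - 2] only makes the
   ratio smaller. *)
exists (fun n => martingale (tail_count k.+2) (n - 2) (G (2 + (n - 2)) w)).
  have := Mw k; move=> /cvgrPdist_le M0; apply/cvgrPdist_le => e e0.
  have [N _ hN] := M0 e e0; exists (N + 3)%N => // n /= hn.
  have {}hN := hN (n - 2)%N; rewrite /= !sub0r !normrN !normrM !normfV in hN *.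
  rewrite !normr_nat in hN *.
  have n0 : 0 < n%:R :> R by rewrite ltr0n; lia.
  have n2 : 0 < (n - 2)%:R :> R by rewrite ltr0n; lia.
  rewrite ler_pdivrMr //; rewrite ler_pdivrMr // in hN.
  apply: (le_trans (hN _)); first by lia.
  by rewrite ler_pM2l // ler_nat leq_subr.
move=> n n2; rewrite (martingaleE hG) // subnKC //.
rewrite (eq_big_nat _ _ (F2 := fun m => drift (tail_count k.+2) (G m w))).
  by ring.
move=> m /andP[m2 _]; rewrite (drift_tail_count _ _ (regular_process hG w m2)) //.
exact: ltnW.
Qed.

End UnitSteps.

(** * Growth of a fixed degree *)

Section LogarithmicGrowth.
Context {R : realType}.
Implicit Types (a b Q : nat -> R) (l : R).

(** Stands in for [1 / n], to which it is equivalent, so that sums telescope exactly to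
    logarithms. *)
Definition dln (n : nat) : R := ln n.+1%:R - ln n%:R.

Lemma dln_bounds (n : nat) : (0 < n)%N -> n.+1%:R^-1 <= dln n <= n%:R^-1.
Proof.
move=> n0; have nR : 0 < n%:R :> R by rewrite ltr0n.
have nS : 0 < n.+1%:R :> R by rewrite ltr0n.
rewrite /dln; apply/andP; split.
  rewrite -lerN2 opprB -ln_div ?posrE //.
  have -> : n%:R / n.+1%:R = 1 + - n.+1%:R^-1 :> R.
    by rewrite -[n.+1%:R]natr1; field; rewrite natr1 gt_eqF.
  by apply: le_ln1Dx; rewrite ltrN2 invf_lt1 // ltr1n.
rewrite -ln_div ?posrE //.
have -> : n.+1%:R / n%:R = 1 + n%:R^-1 :> R.
  by rewrite -[n.+1%:R]natr1; field; rewrite gt_eqF.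
by apply: le_ln1Dx; apply: (@lt_trans _ _ 0); rewrite ?ltrN10 ?invr_gt0.
Qed.

Lemma dln_gt0 (n : nat) : (0 < n)%N -> 0 < dln n.
Proof.
by move=> /dln_bounds /andP[+ _]; apply: lt_le_trans; rewrite invr_gt0.
Qed.

Lemma inv_le_dln (n : nat) : (0 < n)%N -> n%:R^-1 <= 2 * dln n.
Proof.
move=> n0; have /andP[+ _] := dln_bounds n0.
have : (2 * n)%:R^-1 <= n.+1%:R^-1 :> R.
  by rewrite lef_pV2 ?posrE ?ltr0n ?ler_nat; lia.
by rewrite natrM invfM => h1 h2; have := le_trans h1 h2; rewrite ler_pdivrMl.
Qed.

Lemma sum_dln (m n : nat) : (m <= n)%N ->
  \sum_(m <= k < n) dln k = ln n%:R - ln m%:R.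
Proof. by move=> mn; rewrite telescope_sumr. Qed.

Lemma cvg_inv_dln : (n%:R * dln n)^-1 @[n --> \oo] --> (1 : R).
Proof.
rewrite -[X in _ --> X]invr1; apply: cvgV; first exact: oner_neq0.
apply: (@squeeze_cvgr _ _ _ _ (fun n => 1 - harmonic n) (fun=> 1)).
- near=> n; have n0 : (0 < n)%N by near: n; exact: nbhs_infty_gt.
  have nR : 0 < n%:R :> R by rewrite ltr0n.
  have nS : 0 < n.+1%:R :> R by rewrite ltr0n.
  have /andP[h1 h2] := dln_bounds n0; apply/andP; split.
    rewrite (_ : 1 - _ = n%:R * n.+1%:R^-1) ?ler_pM2l //.
    by rewrite /harmonic /= -natr1; field; rewrite natr1 gt_eqF.
  by rewrite -[leRHS](divff (lt0r_neq0 nR)) ler_pM2l.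
- by rewrite -[X in _ --> X]subr0; apply: cvgB; [exact: cvg_cst|exact: cvg_harmonic].
- exact: cvg_cst.
Unshelve. all: by end_near. Qed.

Lemma ln_natr_cvgy : (ln n%:R : R) @[n --> \oo] --> +oo.
Proof.
apply/cvgryPge => A; near=> n; rewrite -[A]expRK ler_ln ?posrE ?expR_gt0 //.
  by near: n; exact: nbhs_infty_ger.
by rewrite ltr0n; near: n; exact: nbhs_infty_gt.
Unshelve. all: by end_near. Qed.

Lemma stolz_cesaro_ln (a : nat -> R) (m : nat) l : (0 < m)%N ->
  a n / dln n @[n --> \oo] --> l ->
  (\sum_(m <= k < n) a k) / ln n%:R @[n --> \oo] --> l.
Proof.
move=> m0 al; apply/cvgrPdist_le => e e0.
have e2 : 0 < e / 2 by rewrite divr_gt0.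
have /cvgrPdist_le /(_ _ e2) [N _ hN] := al.
pose M := maxn N m.
pose K := `|l * ln M%:R - \sum_(m <= k < M) a k|.
have M0 : (0 < M)%N by rewrite /M; lia.
have bound n : (M <= n)%N ->
    `|l * ln n%:R - \sum_(m <= k < n) a k| <= K + e / 2 * ln n%:R.
  move=> Mn.
  have -> : l * ln n%:R - \sum_(m <= k < n) a k
    = (l * ln M%:R - \sum_(m <= k < M) a k)
      + \sum_(M <= k < n) (l * dln k - a k).
    rewrite sumrB -mulr_sumr sum_dln // (@big_cat_nat _ _ _ M) //=.
      by ring.
    by rewrite /M; lia.
  apply: (le_trans (ler_normD _ _)); rewrite lerD2l.
  apply: (le_trans (ler_norm_sum _ _ _)).
  apply: (@le_trans _ _ (\sum_(M <= k < n) e / 2 * dln k)).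
    rewrite big_nat [leRHS]big_nat; apply: ler_sum => k /andP[Mk _].
    have k0 : (0 < k)%N by lia.
    have := hN k; rewrite /= => hk.
    have {}hk : `|l - a k / dln k| <= e / 2 by apply: hk; rewrite /M in Mk; lia.
    have dk := dln_gt0 k0.
    rewrite -[X in _ - X](divfK (lt0r_neq0 dk)) -mulrBl normrM (gtr0_norm dk).
    by rewrite ler_pM2r.
  rewrite -mulr_sumr sum_dln // ler_pM2l // gerBl ln_ge0 // ler1n.
  by lia.
have [N' _ hN'] : \forall n \near \oo, K / (e / 2) + 1 <= ln n%:R :> R.
  by move/cvgryPge : ln_natr_cvgy; apply.
exists (maxn M N') => // n /= hn.
have Kl : K / (e / 2) + 1 <= ln n%:R by apply: hN' => /=; lia.
have K0 : 0 <= K / (e / 2) by rewrite divr_ge0 ?normr_ge0 ?(ltW e2).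
have l0 : 0 < ln n%:R :> R by lra.
rewrite -[X in X - _](mulfK (lt0r_neq0 l0)) -mulrBl normrM normfV (gtr0_norm l0).
rewrite ler_pdivrMr //; apply: le_trans (bound n _) _; first by lia.
have : K <= e / 2 * ln n%:R by rewrite -ler_pdivrMl // mulrC; lra.
by lra.
Qed.

Lemma exists_index_between (N : nat -> nat) (n : nat) :
  (forall k, (N k < N k.+1)%N) -> (N 0 <= n)%N ->
  exists k, (N k <= n < N k.+1)%N.
Proof.
move=> NS; elim: n => [|n IHn] N0n.
  by exists 0%N; rewrite N0n; have := NS 0%N; lia.
have [nN|Nn] := leqP (N 0%N) n; last first.
  by exists 0%N; have := NS 0%N; lia.
have [k hk] := IHn nN.
have [Sk|kS] := ltnP n.+1 (N k.+1); first by exists k; lia.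
by exists k.+1; have := NS k.+1; lia.
Qed.

(** Between [N k] and [N k.+1] monotonicity squeezes the quotient between [Q (N k) / b (N k.+1)] and
    [Q (N k.+1) / b (N k)]; both tend to [l] since consecutive values of [b] are asymptotically
    equal. *)
Lemma cvg_along_subsequence Q b l (N : nat -> nat) :
  (forall k, (N k < N k.+1)%N) ->
  (forall n, (N 0 <= n)%N -> 0 <= Q n <= Q n.+1) ->
  (forall n, (N 0 <= n)%N -> 0 < b n <= b n.+1) ->
  Q (N k) / b (N k) @[k --> \oo] --> l ->
  b (N k.+1) / b (N k) @[k --> \oo] --> (1 : R) ->
  Q n / b n @[n --> \oo] --> l.
Proof.
move=> NS QS bS Ql b1.
have mono (F : nat -> R) m n : (forall n, (N 0 <= n)%N -> F n <= F n.+1) ->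
    (N 0 <= m)%N -> (m <= n)%N -> F m <= F n.
  move=> FS Nm; elim: n => [|n IHn]; first by rewrite leqn0 => /eqP ->.
  rewrite leq_eqVlt => /predU1P[->//|mn].
  by apply: le_trans (IHn mn) (FS _ _); lia.
have N0 k : (N 0 <= N k)%N.
  by elim: k => // k /leq_trans; apply; exact: ltnW.
have kN k : (k <= N k)%N.
  by elim: k => // k IHk; apply: leq_ltn_trans IHk (NS k).
have bN k : b (N k) != 0 by have /andP[/lt0r_neq0] := bS _ (N0 k).
have up : Q (N k.+1) / b (N k) @[k --> \oo] --> l.
  rewrite -[l]mulr1; under eq_cvg => k.
    rewrite (_ : Q (N k.+1) / b (N k)
      = (Q (N k.+1) / b (N k.+1)) * (b (N k.+1) / b (N k))); last first.
      by rewrite mulrA divfK.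
    over.
  by apply: cvgM => //; move: Ql; rewrite -cvg_shiftS.
have dn : Q (N k) / b (N k.+1) @[k --> \oo] --> l.
  rewrite -[l]divr1; under eq_cvg => k.
    rewrite (_ : Q (N k) / b (N k.+1)
      = (Q (N k) / b (N k)) / (b (N k.+1) / b (N k))); last first.
      by rewrite invf_div mulrA divfK.
    over.
  by apply: cvgM => //; apply: cvgV => //; exact: oner_neq0.
apply/cvgrPdist_le => e e0.
have /cvgrPdist_le /(_ _ e0) [K1 _ hK1] := up.
have /cvgrPdist_le /(_ _ e0) [K2 _ hK2] := dn.
exists (N (maxn K1 K2)) => // n /= hn.
have [k /andP[kn nk]] := exists_index_between NS (leq_trans (N0 _) hn).
have Kk : (maxn K1 K2 <= k)%N.
  rewrite leqNgt; apply/negP => kK.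
  suff : (N k.+1 <= N (maxn K1 K2))%N by lia.
  rewrite -(subnKC kK); elim: (_ - _)%N => [|j IHj]; first by rewrite addn0.
  by rewrite addnS (leq_trans IHj) // ltnW.
have := hK1 k; have := hK2 k; rewrite /= => h2 h1.
have {}h1 : `|l - Q (N k.+1) / b (N k)| <= e by apply: h1; lia.
have {}h2 : `|l - Q (N k) / b (N k.+1)| <= e by apply: h2; lia.
have N0n : (N 0 <= n)%N by rewrite (leq_trans (N0 k)).
have /andP[Qk0 _] := QS _ (N0 k); have /andP[bk0 _] := bS _ (N0 k).
have /andP[Qn0 _] := QS _ N0n; have /andP[bn0 _] := bS _ N0n.
have QSr m : (N 0 <= m)%N -> Q m <= Q m.+1 by move=> /QS /andP[].
have bSr m : (N 0 <= m)%N -> b m <= b m.+1 by move=> /bS /andP[].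
have Q1 := mono Q _ _ QSr (N0 k) kn.
have Q2 := mono Q _ _ QSr N0n (ltnW nk).
have b1n := mono b _ _ bSr (N0 k) kn.
have b2n := mono b _ _ bSr N0n (ltnW nk).
have lo : Q (N k) / b (N k.+1) <= Q n / b n.
  have bSk := lt_le_trans bn0 b2n.
  by apply: ler_pM; rewrite ?invr_ge0 ?(ltW bSk) ?lef_pV2 ?posrE.
have hi : Q n / b n <= Q (N k.+1) / b (N k).
  by apply: ler_pM; rewrite ?invr_ge0 ?(ltW bn0) ?lef_pV2 ?posrE.
move: h1 h2; rewrite !ler_distlC => /andP[_ h1] /andP[h2 _].
by rewrite (le_trans h2) //= (le_trans hi).
Qed.

End LogarithmicGrowth.

(** * One-step estimates for the squared degree *)

Section SquaredDegree.
Context {R : realType}.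
Implicit Types (g : hgraph).

Definition sq_degree (i : nat) g : R := (degree g i)%:R ^+ 2.

Lemma mean_next_single (n i : nat) (f : hgraph -> R) (c h : R) g :
  regular n g -> (1 <= i <= n)%N ->
  (forall j, (1 <= j <= n)%N -> f (attach g j) = c + (j == i)%:R * h) ->
  mean_next f g = c + h / ((degree g i)%:R * weight g).
Proof.
move=> gr hi fE; have n0 : (0 < n)%N by lia.
rewrite (mean_nextE gr fE); under eq_bigr do rewrite mulrDr.
have gn : nverts g = n by case: gr.
rewrite big_split /= -mulr_suml -{1}gn (sum_attach_prob n0 gr) mul1r.
rewrite (bigD1_seq i) ?mem_index_iota ?iota_uniq //= big1 ?addr0.
  by rewrite eqxx mul1r attach_probE mulrC.
by move=> j /negPf ->; rewrite mul0r mulr0.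
Qed.

Lemma degree_attach_old (n i j : nat) g : regular n g -> (1 <= i <= n)%N ->
  degree (attach g j) i = (degree g i + (j == i))%N.
Proof. by move=> [gn _ _ _] hi; rewrite degree_attach gn; lia. Qed.

Lemma drift_sq_degree (n i : nat) g : regular n g -> (1 <= i <= n)%N ->
  drift (sq_degree i) g = (2 + (degree g i)%:R^-1) / weight g.
Proof.
move=> gr hi; have n0 : (0 < n)%N by lia.
rewrite /drift (mean_next_single (c := sq_degree i g)
  (h := 2 * (degree g i)%:R + 1) gr hi) => [|j hj].
  have w0 := weight_gt0 (R := R) n0 gr.
  have D0 : 0 < (degree g i)%:R :> R.
    by case: gr => _ gpos _ _; rewrite ltr0n gpos.
  by field; rewrite (gt_eqF w0) (gt_eqF D0).
rewrite /sq_degree (degree_attach_old _ gr hi); case: eqP => _.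
  by rewrite addn1 -natr1 mul1r; ring.
by rewrite addn0 mul0r addr0.
Qed.

(** With probability [1 / (D * weight g)] the square of the degree [D] grows by
    [2 * D + 1 <= 3 * D], so the spread is at most [9 * D / weight g <= 18 * D / n]. The AM-GM
    inequality with free parameter [s] trades [D] for its square, whose mean is under control. *)
Lemma spread_sq_degree_le (n i : nat) g (s : R) : regular n g ->
  (1 <= i <= n)%N -> 0 < s ->
  spread (sq_degree i) g <= 18 * dln n * (sq_degree i g / s + s).
Proof.
move=> gr hi s0; have n0 : (0 < n)%N by lia.
apply: (le_trans (spread_le _ n0 gr)).
rewrite (mean_next_single (c := 0)
  (h := (2 * (degree g i)%:R + 1) ^+ 2) gr hi) => [|j hj]; last first.
  rewrite /sq_degree (degree_attach_old _ gr hi); case: eqP => _.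
    by rewrite addn1 -natr1 mul1r; ring.
  by rewrite addn0 subrr expr0n mul0r addr0.
have wn := weight_ge (R := R) gr.
have nR : 0 < n%:R :> R by rewrite ltr0n.
have D1 : 1 <= (degree g i)%:R :> R.
  by case: gr => _ gpos _ _; rewrite ler1n gpos.
have := inv_le_dln (R := R) n0.
rewrite /sq_degree add0r; move: (degree g i)%:R D1 (weight g) wn (dln n).
move=> D D1 w wn dl ndl.
have w0 : 0 < w by apply: lt_le_trans wn; rewrite divr_gt0.
have D0 : 0 < D by exact: lt_le_trans D1.
apply: (@le_trans _ _ (9 * D / w)).
  rewrite invfM mulrA ler_pM2r ?invr_gt0 // ler_pdivrMr //.
  by have := sqr_ge0 (D - 1); nra.
apply: (@le_trans _ _ (9 * D * (2 / n%:R))).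
  rewrite ler_pM2l ?mulr_gt0 // -[leRHS]invrK lef_pV2 ?posrE //.
    by rewrite invf_div.
  by rewrite invr_gt0 divr_gt0.
have AM_GM : 2 * D <= D ^+ 2 / s + s.
  rewrite -subr_ge0 (_ : _ - _ = (D - s) ^+ 2 / s).
    by rewrite divr_ge0 ?sqr_ge0 // ltW.
  by field; rewrite gt_eqF.
have -> : 9 * D * (2 / n%:R) = 9 * (2 * D) * n%:R^-1 by ring.
have -> : 18 * dl * (D ^+ 2 / s + s) = 9 * (D ^+ 2 / s + s) * (2 * dl) by ring.
apply: ler_pM => //; first by rewrite !mulr_ge0 // ltW.
by rewrite ler_pM2l.
Qed.

(** The drift is at most [3 / weight g]; the bounds [weight g >= n / 2] and [1 / n <= 2 * dln n]
    turn 3 into 12. *)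
Lemma mean_next_sq_degree_le (n i : nat) g : regular n g -> (1 <= i <= n)%N ->
  mean_next (sq_degree i) g <= sq_degree i g + 12 * dln n.
Proof.
move=> gr hi; have n0 : (0 < n)%N by lia.
rewrite -lerBlDl -/(drift _ _) (drift_sq_degree gr hi).
have wn := weight_ge (R := R) gr.
have nR : 0 < n%:R :> R by rewrite ltr0n.
have w0 := weight_gt0 (R := R) n0 gr.
have D1 : (degree g i)%:R^-1 <= 1 :> R.
  by case: gr => _ gpos _ _; rewrite invf_le1 ?ler1n ?ltr0n gpos.
have dl := inv_le_dln (R := R) n0.
rewrite ler_pdivrMr //; apply: (@le_trans _ _ (6 * n%:R^-1 * (n%:R / 2))).
  rewrite (_ : _ * (n%:R / 2) = 3); first by lra.
  by field; rewrite gt_eqF.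
apply: ler_pM => //; rewrite ?divr_ge0 ?mulr_ge0 ?invr_ge0 ?(ltW nR) //.
by lra.
Qed.

Lemma sq_degree_le (n i : nat) g : regular n g -> (1 <= i <= n)%N ->
  sq_degree i g <= (n.*2)%:R ^+ 2.
Proof.
move=> [_ _ _ gsum] hi; rewrite /sq_degree ler_sqr ?nnegrE // ler_nat.
apply: leq_trans (ltnW gsum).
by rewrite (bigD1_seq i) ?mem_index_iota ?iota_uniq //= leq_addr.
Qed.

End SquaredDegree.

(** * Second moments of the martingale part of the squared degree *)

Section DegreeMartingale.
Context {d : measure_display} {T : measurableType d} {R : realType}
        {P : probability T R} {G : nat -> T -> hgraph}.
Hypothesis hG : inverse_depreferential P G.
Variables (i m : nat).
Hypotheses (i0 : (1 <= i)%N) (m2 : (2 <= m)%N) (im : (i <= m)%N).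

Let C1 : R := (m.*2)%:R ^+ 2.

Lemma integral_sq_degree_le (k : nat) :
  (\int[P]_w (sq_degree i (G (m + k) w))%:E
   <= (C1 + 12 * (ln (m + k)%:R - ln m%:R))%:E)%E.
Proof.
elim: k => [|k IHk].
  rewrite addn0 subrr mulr0 addr0.
  apply: (@le_trans _ _ (\int[P]_w (cst C1%:E w))%E).
    apply: ge0_le_integral => //.
    - by move=> w _; rewrite lee_fin sqr_ge0.
    - exact/measurable_EFinP/(measurable_process hG).
    move=> w _; rewrite lee_fin.
    by apply: sq_degree_le (regular_process hG w m2) _; rewrite i0.
  by rewrite integral_cst_probability.
have n2 : (2 <= m + k)%N by rewrite (leq_trans m2) ?leq_addr.
have hi : (1 <= i <= m + k)%N by rewrite i0 (leq_trans im) ?leq_addr.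
rewrite addnS (integral_process_next hG (f := sq_degree i)) //; last first.
  by move=> g; exact: sqr_ge0.
have dl0 : 0 <= dln (m + k) :> R by rewrite ltW // dln_gt0 // ltnW.
apply: (@le_trans _ _ (\int[P]_w ((sq_degree i (G (m + k) w))%:E
    + cst (12 * dln (m + k))%:E w))%E).
  apply: ge0_le_integral => //.
  - by move=> w _; rewrite lee_fin mean_next_ge0 // => g; exact: sqr_ge0.
  - exact/measurable_EFinP/(measurable_process hG).
  - apply: emeasurable_funD => //.
    exact/measurable_EFinP/(measurable_process hG).
  move=> w _; rewrite -EFinD lee_fin.
  exact: mean_next_sq_degree_le (regular_process hG w n2) hi.
rewrite ge0_integralD //; last 3 first.
- by move=> w _; rewrite lee_fin sqr_ge0.
- exact/measurable_EFinP/(measurable_process hG).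
- by move=> w _; rewrite lee_fin mulr_ge0.
rewrite integral_cst_probability; apply: (le_trans (leeD IHk (lexx _))).
by rewrite -EFinD lee_fin /dln; lra.
Qed.

Lemma integral_degree_martingale_le (k : nat) (s : R) : 0 < s ->
  (\int[P]_w (martingale (sq_degree i) k (G (m + k) w) ^+ 2)%:E
   <= (18 * ((C1 + 12 * ln (m + k)%:R) / s + s) * ln (m + k)%:R)%:E)%E.
Proof.
move=> s0; have m0 : (0 < m)%N by exact: ltnW.
have lnm : 0 <= ln m%:R :> R by rewrite ln_ge0 // ler1n.
have ln_mono j : (j <= k)%N -> ln (m + j)%:R <= ln (m + k)%:R :> R.
  by move=> jk; rewrite ler_ln ?posrE ?ltr0n ?ler_nat; lia.
have lnk : 0 <= ln (m + k)%:R :> R by rewrite ln_ge0 // ler1n; lia.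
have C10 : 0 <= C1 by exact: sqr_ge0.
pose B := (C1 + 12 * ln (m + k)%:R) / s + s.
have B0 : 0 <= B by rewrite /B addr_ge0 ?divr_ge0 ?addr_ge0 ?mulr_ge0 ?(ltW s0).
apply: (@le_trans _ _ (\sum_(0 <= j < k) 18 * B * dln (m + j))%:E).
  apply: integral_martingale_sqr => // j jk.
  have n2 : (2 <= m + j)%N by rewrite (leq_trans m2) ?leq_addr.
  have hi : (1 <= i <= m + j)%N by rewrite i0 (leq_trans im) ?leq_addr.
  have dl0 : 0 <= dln (m + j) :> R by rewrite ltW // dln_gt0 // ltnW.
  have c0 : 0 <= 18 * dln (m + j) / s :> R by rewrite !mulr_ge0 ?invr_ge0 ?(ltW s0).
  apply: (@le_trans _ _ (\int[P]_w ((18 * dln (m + j) / s)%:E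
      * (sq_degree i (G (m + j) w))%:E + cst (18 * dln (m + j) * s)%:E w))%E).
    apply: ge0_le_integral => //.
    - by move=> w _; rewrite lee_fin spread_ge0.
    - exact/measurable_EFinP/(measurable_process hG).
    - apply: emeasurable_funD => //.
      apply: measurable_funeM.
      exact/measurable_EFinP/(measurable_process hG).
    move=> w _; rewrite -EFinM -EFinD lee_fin.
    apply: (le_trans (spread_sq_degree_le (regular_process hG w n2) hi s0)).
    by rewrite mulrDr; lra.
  rewrite ge0_integralD //; last 3 first.
  - by move=> w _; rewrite -EFinM lee_fin mulr_ge0 ?sqr_ge0.
  - apply: measurable_funeM.
    exact/measurable_EFinP/(measurable_process hG).
  - by move=> w _; rewrite lee_fin !mulr_ge0 ?(ltW s0).
  rewrite ge0_integralZl ?lee_fin //; last 2 first.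
  - exact/measurable_EFinP/(measurable_process hG).
  - by move=> w _; rewrite lee_fin sqr_ge0.
  rewrite integral_cst_probability.
  apply: (@le_trans _ _ ((18 * dln (m + j) / s)%:E
      * (C1 + 12 * ln (m + k)%:R)%:E + (18 * dln (m + j) * s)%:E)%E).
    apply: leeD => //; apply: lee_wpmul2l; rewrite ?lee_fin //.
    apply: (le_trans (integral_sq_degree_le j)); rewrite lee_fin.
    by have := ln_mono j (ltnW jk); lra.
  rewrite -EFinM -EFinD lee_fin /B le_eqVlt; apply/orP; left; apply/eqP.
  by ring.
rewrite lee_fin -mulr_sumr -/B ler_wpM2l ?mulr_ge0 //.
have -> : \sum_(0 <= j < k) dln (m + j) = \sum_(m <= j < m + k) dln j :> R.
  rewrite -[in RHS](add0n m) big_addn add0n addKn.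
  by apply: eq_bigr => j _; rewrite addnC.
by rewrite sum_dln ?leq_addr // gerBl.
Qed.

(** The logarithm of this time grows like the fourth power of [k.+1]: fast enough for
    [log ^ (3/2) / log ^ 2] to be summable, slowly enough for consecutive logarithms to have ratio
    tending to one. *)
Definition dyadic_time (k : nat) : nat := (m * 2 ^ k.+1 ^ 4)%N.

Lemma dyadic_time_ge (k : nat) : (m <= dyadic_time k)%N.
Proof. by rewrite leq_pmulr // expn_gt0. Qed.

Lemma ln_dyadic_time (k : nat) :
  ln (dyadic_time k)%:R = ln m%:R + k.+1%:R ^+ 4 * ln 2 :> R.
Proof.
rewrite /dyadic_time natrM lnM ?posrE ?ltr0n ?expn_gt0 ?(ltnW m2) //.
by rewrite natrX lnXn // -natrX mulr_natl.
Qed.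

Lemma ae_degree_martingale_cvg0 : {ae P, forall w,
  martingale (sq_degree i) (dyadic_time k - m) (G (dyadic_time k) w)
    / k.+1%:R ^+ 4 @[k --> \oo] --> (0 : R)}.
Proof.
pose Z k w := (k.+1%:R ^+ 4)^-1 * martingale (sq_degree i)
  (dyadic_time k - m) (G (m + (dyadic_time k - m)) w) : R.
pose C2 : R := ln m%:R + ln 2.
have ln2 : 0 < ln 2 :> R by rewrite ln_gt0 // ltr1n.
have lnm : 0 <= ln m%:R :> R by rewrite ln_ge0 // ler1n ltnW.
have C20 : 0 <= C2 by rewrite addr_ge0 // ltW.
have C10 : 0 <= C1 by exact: sqr_ge0.
have mZ k : measurable_fun setT (Z k).
  apply: (measurable_process hG (fun g => (k.+1%:R ^+ 4)^-1 *
    martingale (sq_degree i) (dyadic_time k - m) g)).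
  by rewrite (leq_trans m2) ?leq_addr.
have intZ k : (\int[P]_w (Z k w ^+ 2)%:E
    <= (18 * (C1 + 12 * C2 + 1) * C2 / k.+1%:R ^+ 2)%:E)%E.
  rewrite (integral_scaled_martingale_sqr hG) //.
  set q : R := k.+1%:R; have q1 : 1 <= q by rewrite ler1n.
  have q0 : 0 < q by exact: lt_le_trans q1.
  have q2 : 1 <= q ^+ 2 by rewrite exprn_ege1.
  have q4 : 1 <= q ^+ 4 by rewrite exprn_ege1.
  (* The AM-GM parameter is [q ^+ 2], the square root of the order of the logarithm. The second
     moment is then of order [q ^+ 6], to be divided by [q ^+ 8]. *)
  have s0 : 0 < q ^+ 2 by rewrite exprn_gt0.
  apply: (@le_trans _ _ (((q ^+ 4)^-1 ^+ 2)%:E *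
      (18 * ((C1 + 12 * C2 + 1) * q ^+ 2) * (C2 * q ^+ 4))%:E)%E).
    apply: lee_wpmul2l; first by rewrite lee_fin sqr_ge0.
    apply: (le_trans (integral_degree_martingale_le (dyadic_time k - m) s0)).
    rewrite subnKC ?dyadic_time_ge // ln_dyadic_time -/q lee_fin.
    set L := ln m%:R + _.
    have LC : L <= C2 * q ^+ 4 by rewrite /L /C2; nra.
    have L0 : 0 <= L by rewrite /L addr_ge0 // mulr_ge0 // ltW // exprn_gt0.
    apply: ler_pM => //.
      rewrite mulr_ge0 // addr_ge0 ?(ltW s0) // divr_ge0 ?(ltW s0) //.
      by rewrite addr_ge0 // mulr_ge0.
    rewrite ler_pM2l // [leRHS]mulrDl mul1r lerD2r ler_pdivrMr // -mulrA -exprD.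
    rewrite [leRHS]mulrDl lerD //; first by rewrite ler_peMr.
    by rewrite -mulrA ler_pM2l.
  rewrite -EFinM lee_fin le_eqVlt; apply/orP; left; apply/eqP.
  by field; rewrite gt_eqF.
have := ae_cvg0_of_sqr mZ intZ; apply: filterS => w.
by under eq_cvg do rewrite /Z subnKC ?dyadic_time_ge // mulrC.
Qed.

End DegreeMartingale.

(** * Pathwise growth of the squared degree *)

Section DegreeGrowth.
Context {d : measure_display} {T : measurableType d} {R : realType}
        {P : probability T R} {G : nat -> T -> hgraph}.
Hypothesis hG : inverse_depreferential P G.
Variables (i m : nat).
Hypotheses (i0 : (1 <= i)%N) (m2 : (2 <= m)%N) (im : (i <= m)%N).

Lemma degree_process_bounds (n : nat) (w : T) : (m <= n)%N ->
  (1 <= degree (G n w) i <= degree (G n.+1 w) i)%N.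
Proof.
move=> mn; have n2 : (2 <= n)%N by exact: leq_trans mn.
have gr := regular_process hG w n2; have hi : (1 <= i <= n)%N by lia.
have [j hj ->] := idp_step hG w n2; rewrite (degree_attach_old j gr hi) leq_addr.
by case: gr => _ gpos _ _; rewrite gpos.
Qed.

Lemma sq_degree_process_mono (n p : nat) (w : T) : (m <= n)%N -> (n <= p)%N ->
  sq_degree i (G n w) <= sq_degree i (G p w) :> R.
Proof.
move=> mn; elim: p => [|p IHp]; first by rewrite leqn0 => /eqP ->.
rewrite leq_eqVlt => /predU1P[->//|np].
apply: le_trans (IHp np) _; rewrite ler_sqr ?nnegrE // ler_nat.
by have /andP[] := degree_process_bounds w (leq_trans mn np).
Qed.

Lemma dyadic_time_lt (k : nat) : (dyadic_time m k < dyadic_time m k.+1)%N.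
Proof. by rewrite ltn_pmul2l ?ltn_exp2l ?ltn_exp2r // ltnW. Qed.

Lemma dyadic_time_cvgy : dyadic_time m k @[k --> \oo] --> \oo.
Proof.
have kN k : (k <= dyadic_time m k)%N.
  by elim: k => // k IHk; exact: leq_ltn_trans IHk (dyadic_time_lt k).
apply/cvgnyPge => A; near=> k; apply: leq_trans (kN k).
by near: k; exact: nbhs_infty_ge.
Unshelve. all: by end_near. Qed.

Let ln2 : 0 < ln 2 :> R.
Proof. by rewrite ln_gt0 // ltr1n. Qed.

Let lnm : 0 <= ln m%:R :> R.
Proof. by rewrite ln_ge0 // ler1n ltnW. Qed.

(** The ratio lies between one and the fourth power of [1 + 1 / k.+1]; the common summand [ln m%:R]
    only brings it closer to one. *)
Lemma cvg_ln_dyadic_ratio :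
  ln (dyadic_time m k.+1)%:R / ln (dyadic_time m k)%:R @[k --> \oo] --> (1 : R).
Proof.
apply: (@squeeze_cvgr _ _ _ _ (fun=> 1)
  (fun k => (1 + harmonic k) * (1 + harmonic k)
            * ((1 + harmonic k) * (1 + harmonic k)))).
- near=> k; rewrite !ln_dyadic_time // -[k.+2%:R]natr1 /harmonic /=.
  set q : R := k.+1%:R; have q0 : 0 < q by rewrite ltr0n.
  have L0 : 0 < ln m%:R + q ^+ 4 * ln 2 :> R.
    by rewrite ltr_wpDl // mulr_gt0 // exprn_gt0.
  have qq : q ^+ 4 <= (q + 1) ^+ 4 by rewrite ler_pXn2r ?nnegrE ?addr_ge0 ?(ltW q0) // lerDl.
  rewrite ler_pdivlMr // ler_pdivrMr // mul1r lerD2l ler_pM2r // qq /=.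
  have -> : (1 + q^-1) * (1 + q^-1) * ((1 + q^-1) * (1 + q^-1))
    = (q + 1) ^+ 4 / q ^+ 4 by field; rewrite gt_eqF.
  rewrite mulrDr mulrA divfK ?expf_neq0 ?gt_eqF // lerD2r ler_peMl //.
  by rewrite ler_pdivlMr ?exprn_gt0 // mul1r.
- exact: cvg_cst.
have h1 : (1 + harmonic k : R) @[k --> \oo] --> (1 : R).
  rewrite -[X in _ --> X]addr0; apply: cvgD; first exact: cvg_cst.
  exact: cvg_harmonic.
have h2 : ((1 + harmonic k) * (1 + harmonic k) : R) @[k --> \oo] --> (1 : R).
  by rewrite -[X in _ --> X]mulr1; exact: cvgM.
by rewrite -[X in _ --> X]mulr1; exact: cvgM.
Unshelve. all: by end_near. Qed.

Variables (w : T) (lam : R).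
Hypothesis ratio_cvg : n%:R / weight (G n w) @[n --> \oo] --> lam^-1.

Let M (k : nat) : R :=
  martingale (sq_degree i) (dyadic_time m k - m) (G (dyadic_time m k) w).
Hypothesis M_cvg0 : M k / k.+1%:R ^+ 4 @[k --> \oo] --> (0 : R).

Let a (n : nat) : R := (2 + (degree (G n w) i)%:R^-1) / weight (G n w).

Let sq_degreeE (k : nat) : sq_degree i (G (dyadic_time m k) w)
  = sq_degree i (G m w) + \sum_(m <= j < dyadic_time m k) a j + M k.
Proof.
have mN := dyadic_time_ge m k.
have := martingaleE hG (sq_degree i) (dyadic_time m k - m) w m2.
rewrite subnKC // /M => ->.
rewrite [in RHS](eq_big_nat _ _ (F2 := fun j => drift (sq_degree i) (G j w))).
  by ring.
move=> j /andP[mj _]; have j2 : (2 <= j)%N by exact: leq_trans mj.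
have hij : (1 <= i <= j)%N by rewrite i0 (leq_trans im).
by rewrite (drift_sq_degree (regular_process hG w j2) hij).
Qed.

Let a_ge (n : nat) : (m <= n)%N -> 2 * dln n <= a n.
Proof.
move=> mn; have n2 : (2 <= n)%N by exact: leq_trans mn.
have gr := regular_process hG w n2.
have w0 : 0 < weight (G n w) :> R by exact: weight_gt0 (ltnW n2) gr.
have n0 : 0 < n%:R :> R by rewrite ltr0n ltnW.
have /andP[_ dl] := dln_bounds (R := R) (ltnW n2).
apply: (@le_trans _ _ (2 * n%:R^-1)); first by rewrite ler_pM2l.
apply: ler_pM => //; first by rewrite lerDl.
by rewrite lef_pV2 ?posrE // weight_le.
Qed.

(** With [q = k.+1], at a late dyadic time the drift has contributed at least [2 * q ^ 4 * ln 2],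
    while the martingale is at most [q ^ 4 * ln 2] in absolute value. So the degree is unbounded,
    and being monotone it diverges. *)
Lemma cvg_inv_degree : (degree (G n w) i)%:R^-1 @[n --> \oo] --> (0 : R).
Proof.
apply/cvgrPdist_le => e e0.
have [k hk] : exists k, e^-1 ^+ 2 <= sq_degree i (G (dyadic_time m k) w) :> R.
  near \oo => k; exists k.
  have : `|M k / k.+1%:R ^+ 4| <= ln 2.
    near: k; move/cvgrPdist_le : M_cvg0 => /(_ _ ln2); apply: filterS => k.
    by rewrite sub0r normrN.
  have q4 : k.+1%:R <= k.+1%:R ^+ 4 :> R by rewrite ler_eXnr // ler1n.
  have q0 : 0 < k.+1%:R ^+ 4 :> R by rewrite exprn_gt0.
  rewrite ler_norml => /andP[+ _]; rewrite ler_pdivlMr // => Mk.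
  have sum_ge : 2 * (k.+1%:R ^+ 4 * ln 2)
      <= \sum_(m <= j < dyadic_time m k) a j.
    have -> : k.+1%:R ^+ 4 * ln 2 = ln (dyadic_time m k)%:R - ln m%:R :> R.
      by rewrite ln_dyadic_time // addrC addKr.
    rewrite -sum_dln ?dyadic_time_ge // mulr_sumr big_nat [leRHS]big_nat.
    by apply: ler_sum => j /andP[mj _]; exact: a_ge.
  have eq : e^-1 ^+ 2 / ln 2 <= k.+1%:R.
    near: k; apply: filterS (nbhs_infty_ger (e^-1 ^+ 2 / ln 2)) => k.
    by move=> /le_trans; apply; rewrite ler_nat.
  rewrite ler_pdivrMr // in eq.
  have := ler_wpM2r (ltW ln2) q4.
  have : 0 <= sq_degree i (G m w) :> R by exact: sqr_ge0.
  by rewrite sq_degreeE; lra.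
exists (dyadic_time m k) => // n /= kn; rewrite sub0r normrN normfV normr_nat.
have := le_trans hk (sq_degree_process_mono w (dyadic_time_ge m k) kn).
rewrite ler_sqr ?nnegrE ?invr_ge0 ?(ltW e0) // => h.
rewrite -[leRHS]invrK lef_pV2 ?posrE ?invr_gt0 //.
by apply: lt_le_trans h; rewrite invr_gt0.
Unshelve. all: by end_near. Qed.

(** As the inverse degree vanishes, the drift [a n] is equivalent to [(2 / lam) * dln n], and
    Stolz-Cesaro sums it. The martingale is negligible at dyadic times, and monotonicity extends the
    limit to all times. *)
Lemma cvg_sq_degree :
  sq_degree i (G n w) / ln n%:R @[n --> \oo] --> 2 / lam.
Proof.
have a_dln : a n / dln n @[n --> \oo] --> 2 / lam.
  rewrite (_ : 2 / lam = (2 + 0) * lam^-1 * 1); last by rewrite addr0 mulr1.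
  have : (2 + (degree (G n w) i)%:R^-1) * (n%:R / weight (G n w))
      * (n%:R * dln n)^-1 @[n --> \oo] --> (2 + 0) * lam^-1 * 1.
    apply: cvgM; last exact: cvg_inv_dln.
    apply: cvgM => //; apply: cvgD; first exact: cvg_cst.
    exact: cvg_inv_degree.
  apply: cvg_trans; apply: near_eq_cvg; near=> n.
  have n0 : 0 < n%:R :> R by rewrite ltr0n; near: n; exact: nbhs_infty_gt.
  rewrite /a invfM; rewrite -!mulrA; congr (_ * _).
  rewrite mulrCA; congr (_ * _).
  by rewrite mulrA divff ?mul1r // gt_eqF.
have A_ln := stolz_cesaro_ln (ltnW m2) a_dln.
have L_ge k : k.+1%:R ^+ 4 * ln 2 <= ln (dyadic_time m k)%:R :> R.
  by rewrite ln_dyadic_time // lerDr.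
apply: (cvg_along_subsequence (N := dyadic_time m)
  (Q := fun n => sq_degree i (G n w))).
- exact: dyadic_time_lt.
- move=> n Nn; have mn := leq_trans (dyadic_time_ge m 0) Nn.
  by rewrite sqr_ge0 /= sq_degree_process_mono.
- move=> n Nn; have mn := leq_trans (dyadic_time_ge m 0) Nn.
  have n2 := leq_trans m2 mn; have n0 : (0 < n)%N by exact: ltnW.
  by rewrite ln_gt0 ?ltr1n //= ler_ln ?posrE ?ltr0n // ler_nat.
- have inv_ln0 : (ln n%:R)^-1 @[n --> \oo] --> (0 : R).
    apply/gtr0_cvgV0; last exact: ln_natr_cvgy.
    near=> n; rewrite ln_gt0 // ltr1n.
    by near: n; exact: nbhs_infty_gt.
  rewrite (_ : 2 / lam = sq_degree i (G m w) * 0 + 2 / lam + 0); last first.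
    by rewrite mulr0 add0r addr0.
  have -> : (fun k => sq_degree i (G (dyadic_time m k) w)
      / ln (dyadic_time m k)%:R : R)
    = (fun k => sq_degree i (G m w) * (ln (dyadic_time m k)%:R)^-1
      + (\sum_(m <= j < dyadic_time m k) a j) / ln (dyadic_time m k)%:R
      + M k / ln (dyadic_time m k)%:R).
    by apply/funext => k; rewrite sq_degreeE !mulrDl.
  apply: cvgD; first apply: cvgD.
  + apply: cvgM; first exact: cvg_cst.
    exact: (cvg_comp (dyadic_time m) (fun n => (ln n%:R)^-1) dyadic_time_cvgy).
  + exact: (cvg_comp (dyadic_time m) _ dyadic_time_cvgy A_ln).
  apply/cvgrPdist_le => e e0.
  have e2 : 0 < e * ln 2 by rewrite mulr_gt0.
  move/cvgrPdist_le : M_cvg0 => /(_ _ e2); apply: filterS => k.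
  have q0 : 0 < k.+1%:R ^+ 4 :> R by rewrite exprn_gt0.
  have L0 : 0 < ln (dyadic_time m k)%:R :> R.
    by apply: lt_le_trans (L_ge k); rewrite mulr_gt0.
  rewrite !sub0r !normrN !normrM !normfV (gtr0_norm q0) (gtr0_norm L0).
  rewrite !ler_pdivrMr // => /le_trans; apply.
  by rewrite -mulrA ler_pM2l // mulrC.
exact: cvg_ln_dyadic_ratio.
Unshelve. all: by end_near. Qed.

End DegreeGrowth.

(** * From the squared degree to the degree *)

Theorem theorem2p7 (d : measure_display) (T : measurableType d)
    (R : realType) (P : probability T R) (G : nat -> T -> hgraph)
    (hG : inverse_depreferential P G)
    (i : nat) (hi : (1 <= i)%N)
    (lam : R) (lam_gt0 : 0 < lam)
    (lam_sum : (fun N : nat => \sum_(1 <= n < N)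
        \prod_(1 <= l < n.+1) (1 / (1 + l%:R * lam))) @ \oo --> (1 : R)) :
  {ae P, forall w,
    (fun n : nat => (degree (G n w) i)%:R / Num.sqrt (ln (n%:R : R))) @ \oo
      --> Num.sqrt (2 / lam)}.
Proof.
(* The first time at which the process is running and the vertex [i] is present. *)
pose m := maxn i 2.
have m2 : (2 <= m)%N by rewrite leq_maxr.
have im : (i <= m)%N by rewrite leq_maxl.
have := ae_cvg_ratio_weight hG lam_gt0 lam_sum.
have := ae_degree_martingale_cvg0 hG hi m2 im.
apply: filterS2 => w M0 ratio.
have := cvg_sq_degree hG hi m2 im ratio M0.
move=> /(continuous_cvg _ (@sqrt_continuous R (2 / lam))).
apply: cvg_trans; apply: near_eq_cvg; near=> n.
rewrite /sq_degree /= sqrtrM ?sqr_ge0 // sqrtr_sqr ger0_norm // sqrtrV //.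
by rewrite ln_ge0 // ler1n; near: n; exact: nbhs_infty_gt.
Unshelve. all: by end_near. Qed.
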